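(* Every subprojective Banach space has a subspace with an unconditional basis.
   Context: All Banach spaces are assumed infinite dimensional, and subspaces are closed and infinite dimensional. A Banach space $X$ is subprojective if every subspace $Y \subset X$ contains a further subspace $Z \subset Y$ that is complemented in $X$. *)

(* Defs.v *)
From mathcomp Require Import all_boot all_order all_algebra.
From mathcomp Require Import all_classical all_reals all_analysis.
From mathcomp Require Export complex.

Set Implicit Arguments.
Unset Strict Implicit.
Unset Printing Implicit Defensive.

Import Order.TTheory GRing.Theory Num.Theory.
Import numFieldNormedType.Exports.

Local Open Scope classical_set_scope.
Local Open Scope ring_scope.

Section BanachSubspaces.
Context {K : numFieldType} {X : normedModType K}.
Implicit Types (Y Z : set X) (u e : nat -> X).

Definition finite_dimensional Y : Prop :=
  exists (n : nat) (v : 'I_n -> X), (forall i, Y (v i)) /\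
    forall x, Y x -> exists c : 'I_n -> K, x = \sum_(i < n) c i *: v i.

(* Subspaces are closed and infinite dimensional by convention. *)
Definition banach_subspace Y : Prop :=
  [/\ GRing.submod_closed (mem Y), closed Y & ~ finite_dimensional Y].

(* Complemented in X: Z is the range of a bounded linear projection of X. *)
Definition complemented Z : Prop :=
  exists P : {linear X -> X},
    [/\ continuous P, (forall x, P (P x) = P x) & range P = Z].

Definition unconditionally_cvg u (x : X) : Prop :=
  forall s : nat -> nat, bijective s ->
    series (fun n => u (s n)) @ \oo --> x.

Definition schauder_basis Y e : Prop :=
  (forall n, Y (e n)) /\
  forall x, Y x ->
    exists! a : nat -> K, series (fun n => a n *: e n) @ \oo --> x.

Definition unconditional_basis Y e : Prop :=
  schauder_basis Y e /\
  forall (x : X) (a : nat -> K), Y x ->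
    series (fun n => a n *: e n) @ \oo --> x ->
    unconditionally_cvg (fun n => a n *: e n) x.

End BanachSubspaces.

Definition infinite_dimensional {K : numFieldType} (X : normedModType K) : Prop :=
  ~ finite_dimensional [set: X].

Definition subprojective {K : numFieldType} (X : normedModType K) : Prop :=
  forall Y : set X, banach_subspace Y ->
    exists Z : set X, [/\ banach_subspace Z, Z `<=` Y & complemented Z].

(* Main.v *)
From HB Require Import structures.
Require Import Defs.
From mathcomp Require Import all_boot all_order all_algebra.
From mathcomp Require Import all_classical all_reals all_analysis.
From mathcomp Require Import lra ring.

Set Implicit Arguments.
Unset Strict Implicit.
Unset Printing Implicit Defensive.

Import Order.TTheory GRing.Theory Num.Theory.
Import numFieldNormedType.Exports.

Local Open Scope classical_set_scope.
Local Open Scope ring_scope.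

(** The proof runs the Gowers dichotomy, in the form given to it by Maurey:
    a space that has no unconditional basic sequence contains a subspace in
    which no two infinite dimensional subspaces are at a positive angle, and
    subprojectivity excludes such a subspace.

    Start from a basic sequence e with constant 2 (exists_basic) and consider
    the combinations of e with coefficients in a countable dense subfield k of
    the scalars. They are encoded by {poly k}, the space of finitely supported
    sequences over k, and a subspace of it is large when it meets every tail.
    Call a pair (x, y) accepted by Z when any two large subspaces of Z contain
    u and w such that x + u and y + w nearly coincide, compared with the size
    of their sum, and rejected when no large subspace of Z accepts it. There
    are countably many pairs, so diagonalizing over block sequences gives a
    large Z which accepts or rejects each of them (exists_decides). If it
    rejects (0, 0), then any rejected pair stays rejected after adding, on
    either side, any vector of a suitable large subspace (rejects_extend), and
    a block sequence can be grown all of whose combinations, with coefficients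
    in prescribed finite sets, split into rejected pairs. A rejected pair is in
    particular not close; hence changing signs is bounded on these combinations,
    thus on all of them (nets_suppression), and the block sequence is
    unconditional (suppression_unconditional). If on the contrary (0, 0) is
    accepted for every degree of closeness, a last diagonalization gives a basic
    sequence e' such that any two large subspaces contain pairs of relatively
    arbitrarily close vectors (unconditional_or_indecomposable).

    In the latter case let Z be a subspace of the closed span of the even terms
    of e', complemented by a projection P. Both Z and the kernel of P contain
    nonzero vectors supported arbitrarily far along e': the first because it is
    infinite dimensional, the second because it contains e' (2j+1) - P (e' (2j+1))
    for each j. Both are therefore approximated by large subspaces
    (approximate_subspace), so they contain relatively arbitrarily close vectors,
    which the boundedness of P forbids (subprojective_decomposable).

    Everything is done for an abstract field of scalars with real absolute
    values (the record scalars), instantiated at the end by the reals over the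
    rationals and by the complex numbers over the Gaussian rationals. *)

(** * Linear combinations of a sequence *)

Section Combinations.
Context {K : nzRingType} {X : lmodType K}.
Implicit Types (e : nat -> X) (a b : nat -> K).

Definition comb e a n : X := \sum_(i < n) a i *: e i.

Lemma comb0 e a : comb e a 0 = 0.
Proof. by rewrite /comb big_ord0. Qed.

Lemma combS e a n : comb e a n.+1 = comb e a n + a n *: e n.
Proof. by rewrite /comb big_ord_recr. Qed.

Lemma eq_comb e a b n : (forall i, (i < n)%N -> a i = b i) ->
  comb e a n = comb e b n.
Proof. by move=> ab; apply: eq_bigr => i _; rewrite ab. Qed.

Lemma comb_eq0 e a n : (forall i, (i < n)%N -> a i = 0) -> comb e a n = 0.
Proof. by move=> a0; apply: big1 => i _; rewrite a0 // scale0r. Qed.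

Lemma combP c e a b n :
  comb e (fun i => c * a i + b i) n = c *: comb e a n + comb e b n.
Proof.
rewrite /comb scaler_sumr -big_split; apply: eq_bigr => i _ /=.
by rewrite scalerDl scalerA.
Qed.

Lemma combZ c e a n : comb e (fun i => c * a i) n = c *: comb e a n.
Proof. by rewrite /comb scaler_sumr; apply: eq_bigr => i _; rewrite scalerA. Qed.

Lemma combB e a b n :
  comb e (fun i => a i - b i) n = comb e a n - comb e b n.
Proof.
by rewrite /comb -sumrB; apply: eq_bigr => i _; rewrite scalerBl.
Qed.

Lemma comb_widen e a m n : (m <= n)%N ->
  (forall i, (m <= i)%N -> a i = 0) -> comb e a n = comb e a m.
Proof.
move=> mn a0; rewrite -(subnKC mn); elim: (n - m)%N => [|d IH].
  by rewrite addn0.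
by rewrite addnS combS IH a0 ?leq_addr// scale0r addr0.
Qed.

Lemma comb_trunc e a m n : (m <= n)%N ->
  comb e (fun i => if (i < m)%N then a i else 0) n = comb e a m.
Proof.
move=> mn; rewrite (@comb_widen _ _ m n)//; last first.
  by move=> i; rewrite leqNgt => /negbTE ->.
by apply: eq_comb => i ->.
Qed.

Lemma comb_delta e n m : (m < n)%N ->
  comb e (fun i => (i == m)%:R) n = e m.
Proof.
move=> mn; rewrite (@comb_widen _ _ m.+1)//; last first.
  by move=> i mi; rewrite gtn_eqF.
rewrite combS eqxx scale1r comb_eq0 ?add0r// => i im.
by rewrite ltn_eqF.
Qed.

End Combinations.

(** * Large subspaces of finitely supported sequences *)

Section LargeSubspaces.
Context {k : idomainType}.
Local Notation V := {poly k}.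
Implicit Types (U W Z : set V) (z : nat -> V) (p q : V).

Definition submodule U : Prop :=
  U 0 /\ forall a u v, U u -> U v -> U (a *: u + v).

Definition tail m : set V := [set p | forall i, (i < m)%N -> p`_i = 0].

(** Meeting every tail is a substitute for being infinite dimensional that
    survives, by definition, the passage to finite codimension. *)
Definition large U : Prop :=
  submodule U /\ forall m, exists u, [/\ U u, tail m u & u != 0].

Definition block z : Prop :=
  forall n, z n != 0 /\ tail (size (z n)) (z n.+1).

Definition combine z p : V := comb z (fun i => p`_i) (size p).

Lemma submodule_comb U z a n : submodule U ->
  (forall i, (i < n)%N -> a i != 0 -> U (z i)) -> U (comb z a n).
Proof.
move=> [U0 UP]; elim: n => [|n IH] Uz; first by rewrite comb0.
rewrite combS addrC; have [->|an0] := eqVneq (a n) 0.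
  by rewrite scale0r add0r; apply: IH => i /ltnW; apply: Uz.
by apply: UP; [exact: Uz | apply: IH => i /ltnW; apply: Uz].
Qed.

Lemma submodule_tail m : submodule (tail m).
Proof.
split=> [i _|a u v um vm i im]; first by rewrite coef0.
by rewrite coefD coefZ um// vm// mulr0 addr0.
Qed.

Lemma tail_le m n p : (m <= n)%N -> tail n p -> tail m p.
Proof. by move=> mn pn i im; apply: pn; apply: leq_trans mn. Qed.

Lemma large_setT : large [set: V].
Proof.
split=> // m; exists 'X^m; split=> //; last by rewrite -size_poly_eq0 size_polyXn.
by move=> i im; rewrite coefXn ltn_eqF.
Qed.

Lemma large_tail U m : large U -> large (U `&` tail m).
Proof.
move=> [[U0 UP] Ularge]; split.
  split; first by split=> //; case: (submodule_tail m).
  move=> a u v [Uu tu] [Uv tv]; split; first exact: UP.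
  by case: (submodule_tail m) => _; apply.
move=> n; have [u [Uu tu u0]] := Ularge (maxn m n).
exists u; split=> //; last by apply: tail_le tu; rewrite leq_maxr.
by split=> //; apply: tail_le tu; rewrite leq_maxl.
Qed.

Lemma combineE z p n : (size p <= n)%N -> combine z p = comb z (fun i => p`_i) n.
Proof.
by move=> pn; rewrite /combine [RHS](comb_widen _ pn)// => i; exact: nth_default.
Qed.

Lemma combineP z a p q : combine z (a *: p + q) = a *: combine z p + combine z q.
Proof.
pose n := maxn (size (a *: p + q)) (maxn (size p) (size q)).
rewrite !(@combineE z _ n) ?leq_max ?leqnn ?orbT//= -combP; apply: eq_comb => i _.
by rewrite coefD coefZ.
Qed.

Lemma combine0 z : combine z 0 = 0.
Proof. by rewrite /combine size_poly0 comb0. Qed.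

Section Blocks.
Variable z : nat -> V.
Hypothesis bz : block z.

Lemma block_size_lt n : (size (z n) < size (z n.+1))%N.
Proof.
have [_ t] := bz n; have [+ _] := bz n.+1; rewrite ltnNge; apply: contraNN => s.
apply/eqP/polyP => i; rewrite coef0; have [/t//|si] := ltnP i (size (z n)).
by apply: nth_default; apply: leq_trans si.
Qed.

Lemma block_size_ge n : (n < size (z n))%N.
Proof.
elim: n => [|n IH]; first by rewrite lt0n size_poly_eq0; case: (bz 0).
exact: leq_ltn_trans IH (block_size_lt n).
Qed.

Lemma block_size_mono m n : (m <= n)%N -> (size (z m) <= size (z n))%N.
Proof.
move=> /subnKC <-; elim: (n - m)%N => [|d IH]; first by rewrite addn0.
by rewrite addnS (leq_trans IH)// ltnW// block_size_lt.
Qed.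

Lemma block_tail_size m n : (m < n)%N -> tail (size (z m)) (z n).
Proof.
case: n => // n; rewrite ltnS => mn.
by apply: tail_le (block_size_mono mn) _; case: (bz n).
Qed.

Lemma block_tail n : tail n (z n).
Proof.
case: n => [i//|n]; apply: tail_le (block_tail_size (ltnSn n)).
exact: block_size_ge.
Qed.

Lemma coef_comb (y : nat -> V) a n i :
  (comb y a n)`_i = \sum_(j < n) a j * (y j)`_i.
Proof. by rewrite coef_sum; apply: eq_bigr => j _; rewrite coefZ. Qed.

(** The supports of the blocks are disjoint. *)
Lemma coef_combine_block p i l : (z i)`_l != 0 -> (combine z p)`_l = p`_i * (z i)`_l.
Proof.
move=> zil; rewrite (@combineE z p (maxn (size p) i.+1)) ?leq_maxl// coef_comb.
have ilt : (i < maxn (size p) i.+1)%N by rewrite leq_max ltnSn orbT.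
rewrite (bigD1 (Ordinal ilt))//= big1 ?addr0// => j ji.
have [jlt|ij|ijE] := ltngtP (j : nat) i.
- rewrite [(z j)`_ _]nth_default ?mulr0// leqNgt; apply: contraNN zil => lj.
  by rewrite (block_tail_size jlt lj).
- rewrite (block_tail_size ij) ?mulr0// ltnNge; apply: contraNN zil => il.
  by rewrite nth_default.
- by move: ji; rewrite -val_eqE /= ijE eqxx.
Qed.

Lemma block_last_neq0 i : (z i)`_(size (z i)).-1 != 0.
Proof. by rewrite -lead_coefE lead_coef_eq0; case: (bz i). Qed.

Lemma combine_block_tail p n : tail n p -> tail n (combine z p).
Proof.
move=> tp; apply: submodule_comb; first exact: submodule_tail.
move=> i _; have [/tp ->|ni _] := ltnP i n; first by rewrite eqxx.
exact: tail_le ni (@block_tail i).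
Qed.

Lemma combine_block_tail_inv p n m :
  (forall i, (i < n)%N -> (size (z i) <= m)%N) -> tail m (combine z p) -> tail n p.
Proof.
move=> sm tp i ilt; have := coef_combine_block p (block_last_neq0 i); rewrite tp; last first.
  by rewrite prednK ?sm//; exact: leq_ltn_trans (block_size_ge i).
by move/esym/eqP; rewrite mulf_eq0 (negbTE (block_last_neq0 i)) orbF => /eqP.
Qed.

Lemma combine_block_eq0 p : combine z p = 0 -> p = 0.
Proof.
move=> p0; apply/polyP => i; rewrite coef0.
apply: (@combine_block_tail_inv p i.+1 (size (z i)) _ _ i) => //.
  by move=> j; rewrite ltnS; apply: block_size_mono.
by rewrite p0; case: (submodule_tail (size (z i))).
Qed.

Lemma large_image U : large U -> large (combine z @` U).
Proof.
move=> [[U0 UP] Ularge]; split.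
  split; first by exists 0; rewrite ?combine0.
  move=> a _ _ [u Uu <-] [v Uv <-]; exists (a *: u + v); first exact: UP.
  exact: combineP.
move=> m; have [u [Uu tu u0]] := Ularge m; exists (combine z u); split.
- by exists u.
- exact: combine_block_tail.
- by apply: contra u0 => /eqP/combine_block_eq0 ->.
Qed.

End Blocks.

Lemma exists_block (Z : nat -> set V) : (forall n, large (Z n)) ->
  exists z, block z /\ forall n, Z n (z n).
Proof.
move=> Zl.
have /choice[f fP] : forall np : nat * V, exists u,
    [/\ Z np.1 u, tail (size np.2) u & u != 0].
  by move=> [n p]; case: (Zl n) => _; apply.
pose z := fix z n := if n is m.+1 then f (m.+1, z m) else f (0%N, 0).
exists z; split=> n; last first.
  by case: n => [|n]; [case: (fP (0%N, 0)) | case: (fP (n.+1, z n))].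
split; last by case: (fP (n.+1, z n)).
by case: n => [|n]; [case: (fP (0%N, 0)) | case: (fP (n.+1, z n))].
Qed.

(** Decreasing large subspaces have a large diagonal intersection, up to
    finite codimension; every hereditary property that can be forced one at a
    time can therefore be forced along a whole sequence. *)
Lemma diagonal_block (Q : nat -> set V -> Prop) (Z0 : set V) :
  large Z0 ->
  (forall n Z, large Z -> exists Z', [/\ large Z', Z' `<=` Z & Q n Z']) ->
  (forall n Z Z' m, Q n Z -> Z' `&` tail m `<=` Z -> Q n Z') ->
  exists z, [/\ block z, forall p, Z0 (combine z p) & forall n, Q n (range (combine z))].
Proof.
move=> Z0l Qex Qher.
have /choice[f fP] : forall nZ : nat * set V, exists Z', large nZ.2 ->
    [/\ large Z', Z' `<=` nZ.2 & Q nZ.1 Z'].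
  move=> [n Z]; have [Zl|nZl] := pselect (large Z); last by exists Z.
  by have [Z' Z'P] := Qex n _ Zl; exists Z'.
pose Z := fix Z n := if n is m.+1 then f (m, Z m) else Z0.
have Zl n : large (Z n).
  by elim: n => [//|n IH] /=; case: (fP (n, Z n) IH).
have Zdec m n : (m <= n)%N -> Z n `<=` Z m.
  move=> /subnKC <-; elim: (n - m)%N => [|d IH]; first by rewrite addn0.
  rewrite addnS; apply: subset_trans IH.
  by case: (fP ((m + d)%N, Z (m + d)%N) (Zl _)).
have [z [bz Zz]] := exists_block Zl; exists z; split=> //.
  move=> p; apply: (@submodule_comb Z0); first by case: Z0l.
  by move=> i _ _; exact: (Zdec 0%N i (leq0n i) _ (Zz i)).
move=> n; apply: (@Qher n (Z n.+1) _ (size (z n))).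
  by case: (fP (n, Z n) (Zl _)).
move=> _ [[p _ <-] tp]; apply: (@submodule_comb (Z n.+1)); first by case: (Zl n.+1).
have {}tp : tail n.+1 p.
  apply: (combine_block_tail_inv bz _ tp) => i; rewrite ltnS; exact: block_size_mono.
move=> i _; have [/tp ->|ni _] := ltnP i n.+1; first by rewrite eqxx.
exact: (Zdec _ _ ni _ (Zz i)).
Qed.

(** * A game on pairs of vectors *)

Section Game.
Variable P : V -> V -> Prop.

(** When P holds of relatively close pairs, a subspace accepting (0, 0) is one
    in which no two large subspaces are at a positive angle. *)
Definition accepts Z x y : Prop := forall U W, large U -> large W ->
  U `<=` Z -> W `<=` Z -> exists u w, [/\ U u, W w & P (x + u) (y + w)].

Definition rejects Z x y : Prop :=
  forall Z', large Z' -> Z' `<=` Z -> ~ accepts Z' x y.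

(** The answers can be taken in any tail, so that acceptance and rejection only
    depend on Z up to finite codimension. *)
Lemma accepts_almost Z Z' m x y :
  accepts Z x y -> Z' `&` tail m `<=` Z -> accepts Z' x y.
Proof.
move=> acc Z'Z U W Ul Wl UZ WZ.
have [||u [w [[Uu _] [Ww _] Puw]]] := acc _ _ (large_tail m Ul) (large_tail m Wl).
- by move=> u [/UZ Z'u tu]; apply: Z'Z.
- by move=> u [/WZ Z'u tu]; apply: Z'Z.
by exists u, w.
Qed.

Lemma rejects_almost Z Z' m x y :
  rejects Z x y -> Z' `&` tail m `<=` Z -> rejects Z' x y.
Proof.
move=> rej Z'Z Z'' Z''l Z''Z' acc; apply: (rej _ (large_tail m Z''l)).
  by move=> u [/Z''Z' Z'u tu]; apply: Z'Z.
by apply: (@accepts_almost _ _ 0 _ _ acc) => u [[]].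
Qed.

Lemma rejects_not Z x y : large Z -> rejects Z x y -> ~ P x y.
Proof.
move=> Zl rej Pxy; apply: (rej _ Zl (@subset_refl _ _)) => U W Ul Wl _ _.
exists 0, 0; rewrite !addr0; split=> //.
  by case: Ul => -[].
by case: Wl => -[].
Qed.

Hypothesis Vcount : countable [set: V].

Definition decides Z : Prop := forall x y, accepts Z x y \/ rejects Z x y.

(** Pairs are enumerated, decided one at a time by shrinking Z0, and the
    decisions are inherited by the diagonal. *)
Lemma exists_decides Z0 : large Z0 ->
  exists Z, [/\ large Z, Z `<=` Z0 & decides Z].
Proof.
move=> Z0l; have /countable_injP[f finj] := Vcount.
have {}finj : injective f by move=> x y; apply: finj; rewrite inE.
pose Q n Z := forall x y, pickle (f x, f y) = n -> accepts Z x y \/ rejects Z x y.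
have [|n Z Z' m QZ Z'Z x y xy|z [bz Z0z Qz]] := @diagonal_block Q Z0 Z0l.
- move=> n Z Zl; have [[[x y] /= xyE]|no] :=
      pselect (exists xy : V * V, pickle (f xy.1, f xy.2) = n); last first.
    by exists Z; split=> // x y xyE; case: no; exists (x, y).
  have xyP x' y' : pickle (f x', f y') = n -> x' = x /\ y' = y.
    by rewrite -xyE => /(pcan_inj pickleK)[/finj -> /finj ->].
  have [[Z' [Z'l Z'Z acc]]|no] :=
      pselect (exists Z', [/\ large Z', Z' `<=` Z & accepts Z' x y]).
    by exists Z'; split=> // x' y' /xyP[-> ->]; left.
  exists Z; split=> // x' y' /xyP[-> ->]; right => Z' Z'l Z'Z acc.
  by apply: no; exists Z'.
- have [acc|rej] := QZ _ _ xy; [left|right].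
    exact: accepts_almost acc Z'Z.
  exact: rejects_almost rej Z'Z.
- exists (range (combine z)); split.
  + exact: (large_image bz large_setT).
  + by move=> _ [p _ <-].
  + by move=> x y; apply: (Qz (pickle (f x, f y))).
Qed.

Section Strategy.
Variable Z : set V.
Hypotheses (Zl : large Z) (Zdec : decides Z).

(** If every large subspace of U contained some u with (x + u, y) accepted by
    Z, then the answers to such accepted pairs would show that U accepts
    (x, y): the vector u is absorbed by the subspace it was taken from. *)
Lemma rejects_extend_l U x y : large U -> U `<=` Z -> rejects Z x y ->
  exists U', [/\ large U', U' `<=` U & forall u, U' u -> rejects Z (x + u) y].
Proof.
move=> Ul UZ rej; apply: contrapT => no; apply: (rej U Ul UZ).
move=> U1 W1 U1l W1l U1U W1U.
have [u [U1u acc]] : exists u, U1 u /\ accepts Z (x + u) y.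
  apply: contrapT => nou; apply: no; exists U1; split=> // u U1u.
  by have [acc|//] := Zdec (x + u) y; case: nou; exists u.
have [v [w [U1v W1w Pvw]]] :=
  acc _ _ U1l W1l (subset_trans U1U UZ) (subset_trans W1U UZ).
exists (u + v), w; split=> //; last by rewrite addrA.
by case: U1l => -[_ U1P] _; rewrite -[u]scale1r; apply: U1P.
Qed.

Lemma rejects_extend_r U x y : large U -> U `<=` Z -> rejects Z x y ->
  exists U', [/\ large U', U' `<=` U & forall u, U' u -> rejects Z x (y + u)].
Proof.
move=> Ul UZ rej; apply: contrapT => no; apply: (rej U Ul UZ).
move=> U1 W1 U1l W1l U1U W1U.
have [u [W1u acc]] : exists u, W1 u /\ accepts Z x (y + u).
  apply: contrapT => nou; apply: no; exists W1; split=> // u W1u.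
  by have [acc|//] := Zdec x (y + u); case: nou; exists u.
have [v [w [U1v W1w Pvw]]] :=
  acc _ _ U1l W1l (subset_trans U1U UZ) (subset_trans W1U UZ).
exists v, (u + w); split=> //; last by rewrite addrA.
by case: W1l => -[_ W1P] _; rewrite -[u]scale1r; apply: W1P.
Qed.

Lemma rejects_extend (L : seq (V * V)) :
  (forall p : V * V, p \in L -> rejects Z p.1 p.2) ->
  exists U, [/\ large U, U `<=` Z & forall p : V * V, p \in L -> forall u, U u ->
    rejects Z (p.1 + u) p.2 /\ rejects Z p.1 (p.2 + u)].
Proof.
elim: L => [|p L IH] rejL; first by exists Z; split=> // ? ; rewrite in_nil.
have [|U [Ul UZ UP]] := IH; first by move=> q qL; apply: rejL; rewrite in_cons qL orbT.
have rejp : rejects Z p.1 p.2 by apply: rejL; rewrite mem_head.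
have [U1 [U1l U1U U1P]] := rejects_extend_l Ul UZ rejp.
have [U2 [U2l U2U U2P]] := rejects_extend_r U1l (subset_trans U1U UZ) rejp.
exists U2; split=> //; first exact: subset_trans U2U (subset_trans U1U UZ).
move=> q; rewrite in_cons => /orP[/eqP ->|qL] u U2u.
  by split; [apply: U1P; apply: U2U | apply: U2P].
by apply: UP => //; apply: U1U; apply: U2U.
Qed.

(** The list of pairs that must stay rejected is kept finite by allowing only
    the coefficients g (z i) in front of z i; this list g (z i) may depend on
    the block z i, hence on its norm in the intended application. *)
Lemma exists_rejecting_block (g : V -> seq k) : rejects Z 0 0 ->
  exists z, [/\ block z, forall n, Z (z n) &
    forall n (A : pred nat) (c : nat -> k), (forall i, c i \in g (z i)) ->
    ~ P (\sum_(i < n | A i) c i *: z i) (\sum_(i < n | ~~ A i) c i *: z i)].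
Proof.
move=> rej0.
have /choice[F FP] : forall Lm : seq (V * V) * nat, exists u,
    (forall p : V * V, p \in Lm.1 -> rejects Z p.1 p.2) ->
    [/\ u != 0, tail Lm.2 u, Z u & forall p : V * V, p \in Lm.1 -> forall q : k,
      rejects Z (p.1 + q *: u) p.2 /\ rejects Z p.1 (p.2 + q *: u)].
  move=> [L m] /=; have [rejL|norej] :=
      pselect (forall p : V * V, p \in L -> rejects Z p.1 p.2); last by exists 0.
  have [U [Ul UZ UP]] := rejects_extend rejL.
  have [[U0 Uc] /(_ m)[u [Uu tu u0]]] := Ul; exists u => _; split=> //.
    exact: UZ.
  by move=> p pL q; apply: UP => //; rewrite -[q *: u]addr0; apply: Uc.
pose next (u : V) (L : seq (V * V)) :=
  [seq (p.1 + q *: u, p.2) | p : V * V <- L, q : k <- g u] ++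
  [seq (p.1, p.2 + q *: u) | p : V * V <- L, q : k <- g u].
pose st := fix st n := if n is m.+1 then
  let u := F ((st m).2, size (st m).1) in (u, next u (st m).2)
  else (0 : V, [:: (0 : V, 0 : V)]).
pose z n := (st n.+1).1; pose L n := (st n).2.
have zE n : z n = F (L n, size (st n).1) by [].
have LS n : L n.+1 = next (z n) (L n) by [].
have rejL n (p : V * V) : p \in L n -> rejects Z p.1 p.2.
  elim: n p => [|n IH] p; first by rewrite inE => /eqP ->.
  have [_ _ _ rejn] := FP (L n, size (st n).1) IH.
  rewrite LS mem_cat => /orP[] /allpairsP[[p' q] [/= p'L _ ->]];
  by have [] := rejn _ p'L q; rewrite -zE.
have zP n := FP (L n, size (st n).1) (rejL n).
exists z; split.
- by move=> n; split; [case: (zP n) | case: (zP n.+1)].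
- by move=> n; case: (zP n).
move=> n A c cg; apply: (@rejects_not Z) => //.
suff : (\sum_(i < n | A i) c i *: z i, \sum_(i < n | ~~ A i) c i *: z i) \in L n.
  by move/rejL.
elim: n => [|n IH]; first by rewrite !big_ord0 inE.
have recr (B : pred nat) : \sum_(i < n.+1 | B i) c i *: z i =
    \sum_(i < n | B i) c i *: z i + (if B n then c n *: z n else 0).
  by rewrite big_mkcond big_ord_recr -big_mkcond.
rewrite LS mem_cat (recr A) (recr (fun i => ~~ A i)) /=.
move: IH; set x := \sum_(i < n | A i) _; set y := \sum_(i < n | ~~ A i) _ => IH.
case: (A n); rewrite /= addr0; apply/orP; [left|right].
  by apply/allpairsP; exists ((x, y), c n); split; [exact: IH | exact: cg | ].
by apply/allpairsP; exists ((x, y), c n); split; [exact: IH | exact: cg | ].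
Qed.

End Strategy.

Theorem game_dichotomy (Z0 : set V) (g : V -> seq k) : large Z0 ->
  (exists Z, [/\ large Z, Z `<=` Z0 & accepts Z 0 0]) \/
  (exists z, [/\ block z, forall n, Z0 (z n) &
    forall n (A : pred nat) (c : nat -> k), (forall i, c i \in g (z i)) ->
    ~ P (\sum_(i < n | A i) c i *: z i) (\sum_(i < n | ~~ A i) c i *: z i)]).
Proof.
move=> Z0l; have [Z [Zl ZZ0 Zdec]] := exists_decides Z0l.
have [acc|rej] := Zdec 0 0; first by left; exists Z.
have [z [bz Zz zP]] := exists_rejecting_block Zl Zdec g rej.
by right; exists z; split=> // n; apply: ZZ0.
Qed.

End Game.
End LargeSubspaces.

(** * Real-valued norms *)

(** The common features of the real and of the complex scalars: norms are real
    numbers, Cauchy sequences converge, and a countable subfield k provides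
    finite nets for every disc. *)
Record scalars (R : realType) (K : numFieldType) (k : fieldType) := Scalars {
  emb : {rmorphism R -> K};
  re : K -> R;
  lift_k : {rmorphism k -> K};
  emb_ge0 : forall r, 0 <= r -> 0 <= emb r;
  reK : forall a, 0 <= a -> emb (re a) = a;
  poly_countable : countable [set: {poly k}];
  scalar_net : forall r d : R, 0 < d -> exists s : seq k,
    forall a : K, `|a| <= emb r -> exists2 q, q \in s & `|a - lift_k q| <= emb d;
  scalar_complete : forall u : nat -> K,
    (forall d : R, 0 < d ->
      exists N, forall m n, (N <= m)%N -> (N <= n)%N -> `|u m - u n| <= emb d) ->
    exists l, forall d : R, 0 < d ->
      exists N, forall n, (N <= n)%N -> `|u n - l| <= emb d
}.

Section RealNorm.
Context {R : realType} {K : numFieldType} {k : fieldType}.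
Variable S : scalars R K k.
Local Notation emb := (emb S).
Local Notation re := (re S).

Definition nrm {V : normedZmodType K} (x : V) : R := re `|x|.

Lemma emb_le r s : (emb r <= emb s) = (r <= s).
Proof.
have le u v : u <= v -> emb u <= emb v.
  by move=> uv; rewrite -subr_ge0 -rmorphB; apply: emb_ge0; rewrite subr_ge0.
have [/le//|sr] := leP r s; apply/negbTE/negP => rs.
have /fmorph_inj rsE : emb r = emb s by apply/le_anti; rewrite rs le// ltW.
by move: sr; rewrite rsE ltxx.
Qed.

Lemma emb_lt r s : (emb r < emb s) = (r < s).
Proof. by rewrite !lt_def emb_le (inj_eq (fmorph_inj _)). Qed.

Section NormedZmodule.
Context {V : normedZmodType K}.
Implicit Types x y z : V.

Lemma emb_nrm x : emb (nrm x) = `|x|.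
Proof. by rewrite reK. Qed.

Lemma nrm_le x r : (nrm x <= r) = (`|x| <= emb r).
Proof. by rewrite -emb_nrm emb_le. Qed.

Lemma nrm_ge0 x : 0 <= nrm x.
Proof. by rewrite -emb_le emb_nrm rmorph0. Qed.

Lemma nrm0 : nrm (0 : V) = 0.
Proof. by apply: (fmorph_inj emb); rewrite emb_nrm normr0 rmorph0. Qed.

Lemma nrm_eq0 x : (nrm x == 0) = (x == 0).
Proof. by rewrite -(inj_eq (fmorph_inj emb)) emb_nrm rmorph0 normr_eq0. Qed.

Lemma nrm_gt0 x : (0 < nrm x) = (x != 0).
Proof. by rewrite lt_def nrm_eq0 nrm_ge0 andbT. Qed.

Lemma nrmN x : nrm (- x) = nrm x.
Proof. by rewrite /nrm normrN. Qed.

Lemma nrm_distC x y : nrm (x - y) = nrm (y - x).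
Proof. by rewrite /nrm distrC. Qed.

Lemma nrmD x y : nrm (x + y) <= nrm x + nrm y.
Proof. by rewrite nrm_le rmorphD /= !emb_nrm ler_normD. Qed.

Lemma nrmB x y : nrm (x - y) <= nrm x + nrm y.
Proof. by rewrite -(nrmN y) nrmD. Qed.

Lemma nrm_dist z x y : nrm (x - y) <= nrm (x - z) + nrm (z - y).
Proof. by rewrite -[x - y](subrKA z) nrmD. Qed.

Lemma nrm_sub x y : nrm x <= nrm y + nrm (x - y).
Proof. by have := nrmD y (x - y); rewrite subrKC. Qed.

Lemma nrm_sum n (f : 'I_n -> V) : nrm (\sum_(i < n) f i) <= \sum_(i < n) nrm (f i).
Proof.
elim: n f => [|n IH] f; first by rewrite !big_ord0 nrm0.
by rewrite !big_ord_recr /= (le_trans (nrmD _ _))// lerD2r IH.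
Qed.

Lemma nrm_small x : (forall d : R, 0 < d -> nrm x <= d) -> x = 0.
Proof.
move=> xd; apply/eqP; rewrite -nrm_eq0 eq_le nrm_ge0 andbT.
by apply/ler_addgt0Pl => d d0; rewrite addr0 xd.
Qed.

Definition tends (u : nat -> V) (x : V) : Prop := forall d : R, 0 < d ->
  exists N, forall n, (N <= n)%N -> nrm (u n - x) <= d.

Lemma tends_unique u x y : tends u x -> tends u y -> x = y.
Proof.
move=> ux uy; apply/eqP; rewrite -subr_eq0; apply/eqP/nrm_small => d d0.
have d20 : 0 < d / 2 by lra.
have [N uN] := ux _ d20; have [M uM] := uy _ d20.
have := nrm_dist (u (maxn N M)) x y; rewrite (nrm_distC x (u _)).
have := uN _ (leq_maxl N M); have := uM _ (leq_maxr N M); lra.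
Qed.

Lemma tends_nrm_le u x r : tends u x ->
  (exists N, forall n, (N <= n)%N -> nrm (u n) <= r) -> nrm x <= r.
Proof.
move=> ux [N uN]; apply/ler_addgt0Pl => d d0; have [M uM] := ux _ d0.
have := nrm_sub x (u (maxn N M)); rewrite nrm_distC.
have := uN _ (leq_maxl N M); have := uM _ (leq_maxr N M); lra.
Qed.

End NormedZmodule.

Lemma nrm_emb r : 0 <= r -> nrm (emb r) = r.
Proof.
by move=> r0; apply: (fmorph_inj emb); rewrite emb_nrm ger0_norm ?emb_ge0.
Qed.

Section NormedModule.
Context {X : normedModType K}.
Implicit Types (x y : X) (e : nat -> X).

Lemma nrmZ (a : K) x : nrm (a *: x) = nrm a * nrm x.
Proof. by apply: (fmorph_inj emb); rewrite rmorphM /= !emb_nrm normrZ. Qed.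

Lemma nrm_nat x n : nrm (x *+ n) = nrm x *+ n.
Proof.
by apply: (fmorph_inj emb); rewrite raddfMn /= !emb_nrm -scaler_nat normrZ
  normr_nat mulr_natl.
Qed.

Lemma tendsP (u : nat -> X) x : (u @ \oo --> x) <-> tends u x.
Proof.
split=> [/cvgrPdist_le ux d d0|ux].
  have [|N _ uN] := ux (emb d); first by rewrite -(rmorph0 emb) emb_lt.
  by exists N => n Nn; rewrite nrm_le distrC; exact: uN.
apply/cvgrPdist_le => d d0; have dE : emb (re d) = d by rewrite reK// ltW.
have [|N uN] := ux (re d); first by rewrite -emb_lt dE rmorph0.
by exists N => // n Nn /=; rewrite distrC -dE -nrm_le; exact: uN.
Qed.

Lemma tends_comb e (a : nat -> nat -> K) (l : nat -> K) n :
  (forall i, tends (a ^~ i) (l i)) -> tends (fun m => comb e (a m) n) (comb e l n).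
Proof.
move=> al; elim: n => [|n IH] d d0.
  by exists 0%N => m _; rewrite !comb0 subrr nrm0 ltW.
have d20 : 0 < d / 2 by lra.
have e0 : 0 < nrm (e n) + 1 by rewrite ltr_wpDl// nrm_ge0.
have [N aN] := IH _ d20; have [M aM] := al n _ (divr_gt0 d20 e0).
exists (maxn N M) => m; rewrite geq_max => /andP[/aN aNm /aM].
rewrite ler_pdivlMr// => aMm.
rewrite !combS opprD addrACA -scalerBl (le_trans (nrmD _ _))// nrmZ.
have := nrm_ge0 (a m n - l n); nra.
Qed.

Definition adherent (A : set X) x : Prop :=
  forall d : R, 0 < d -> exists2 y, A y & nrm (y - x) <= d.

Lemma closed_adherent (A : set X) : (forall x, adherent A x -> A x) -> closed A.
Proof.
move=> Acl x clx; apply: Acl => d d0.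
have /clx[y [Ay]] : nbhs x (ball x (emb d)).
  by apply: nbhsx_ballx; rewrite -(rmorph0 emb) emb_lt.
rewrite -ball_normE /ball_ /= => yd; exists y => //.
by rewrite nrm_distC nrm_le ltW.
Qed.

Lemma linear_bound (P : {linear X -> X}) : continuous P ->
  exists2 M : R, 0 <= M & forall x, nrm (P x) <= M * nrm x.
Proof.
move=> /(_ 0); rewrite /continuous_at linear0 => /cvgrPdist_le /(_ 1 ltr01).
move=> /nbhs_ballP[d /= d0 dP]; have dE : emb (re d) = d by rewrite reK// ltW.
have rd0 : 0 < re d by rewrite -emb_lt dE rmorph0.
exists (2 / re d); first by rewrite ltW ?divr_gt0.
move=> x; have [->|x0] := eqVneq x 0; first by rewrite linear0 !nrm0 mulr0.
have nx : 0 < nrm x by rewrite nrm_gt0.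
pose t := re d / 2 / nrm x; have t0 : 0 < t by rewrite !divr_gt0.
have : nrm (P (emb t *: x)) <= 1.
  rewrite nrm_le rmorph1 -normrN -sub0r; apply: dP.
  rewrite -ball_normE /ball_ /= sub0r normrN -emb_nrm -dE emb_lt nrmZ (nrm_emb (ltW t0)).
  by rewrite /t divfK ?gt_eqF//; lra.
rewrite linearZ nrmZ (nrm_emb (ltW t0)) -ler_pdivlMl// mulr1 => /le_trans; apply.
by rewrite /t !invf_div mulrC [_ / _ * _]mulrC lexx.
Qed.

End NormedModule.

Lemma scalar_cauchy (u : nat -> K) :
  (forall d : R, 0 < d ->
    exists N, forall m n, (N <= m)%N -> (N <= n)%N -> nrm (u m - u n) <= d) ->
  exists l, tends u l.
Proof.
move=> uc; have [|l ul] := @scalar_complete _ _ _ S u.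
  by move=> d /uc[N uN]; exists N => m n Nm Nn; rewrite -nrm_le; exact: uN.
by exists l => d /ul[N uN]; exists N => n Nn; rewrite nrm_le; exact: uN.
Qed.

(** The compactness of finite dimensional balls, with nets built one
    coordinate at a time. *)
Lemma comb_net (X : normedModType K) (e : nat -> X) n (r d : R) : 0 < d ->
  exists L : seq X, forall a : nat -> K,
    (forall i, (i < n)%N -> nrm (a i) <= r) ->
    exists2 y, y \in L & nrm (comb e a n - y) <= d.
Proof.
elim: n d => [|n IH] d d0.
  by exists [:: 0] => a _; exists 0; rewrite ?mem_head// comb0 subrr nrm0 ltW.
have d20 : 0 < d / 2 by lra.
have e0 : 0 < nrm (e n) + 1 by rewrite ltr_wpDl// nrm_ge0.
have [L LP] := IH _ d20.
have [s sP] := scalar_net S r (divr_gt0 d20 e0).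
exists [seq y + lift_k S q *: e n | y <- L, q <- s] => a ar.
have [|y yL yd] := LP a; first by move=> i ilt; apply/ar/ltnW.
have [|q qs] := sP (a n); first by rewrite -nrm_le ar.
rewrite -nrm_le ler_pdivlMr// => qd.
exists (y + lift_k S q *: e n); first by apply/allpairsP; exists (y, q).
rewrite combS opprD addrACA -scalerBl (le_trans (nrmD _ _))// nrmZ.
have := nrm_ge0 (a n - lift_k S q); nra.
Qed.

End RealNorm.

(** * Finite dimension *)

Lemma kernel_vector (F : fieldType) n (c : nat -> nat -> F) :
  exists t : nat -> F, (exists2 j, (j < n.+1)%N & t j != 0) /\
    forall i, (i < n)%N -> \sum_(j < n.+1) t j * c j i = 0.
Proof.
pose M := \matrix_(j < n.+1, i < n) c j i.
have /rowV0Pn[v /sub_kermxP vM v0] : kermx M != 0.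
  rewrite -mxrank_eq0 mxrank_ker subn_eq0 -ltnNge ltnS; exact: rank_leq_col.
have [j vj] : exists j, v 0 j != 0.
  apply: contrapT => no; move/eqP: v0; apply; apply/rowP => j; rewrite mxE.
  by apply/eqP/negPn/negP => vj; apply: no; exists j.
exists (fun j => v 0 (inord j)); split; first by exists j; rewrite ?inord_val.
move=> i ilt; have /rowP/(_ (Ordinal ilt)) := vM; rewrite !mxE => vMi; rewrite -[RHS]vMi.
by apply: eq_bigr => l _; rewrite mxE inord_val.
Qed.

Section FiniteDimension.
Context {K : numFieldType} {X : normedModType K}.
Implicit Types (Z : set X) (f : nat -> X).

Definition independent f : Prop :=
  forall n t, comb f t n = 0 -> forall i, (i < n)%N -> t i = 0.

Lemma independent_infinite_dim Z f : independent f -> (forall n, Z (f n)) ->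
  ~ finite_dimensional Z.
Proof.
move=> find Zf [n [v [_ span]]].
have /choice[c cP] : forall j, exists c : nat -> K, f j = \sum_(i < n) c i *: v i.
  move=> j; have [c ->] := span _ (Zf j).
  exists (fun i => if insub i is Some o then c o else 0).
  by apply: eq_bigr => i _; rewrite valK.
have [t [[j jn tj] tP]] := kernel_vector n c.
suff f0 : comb f t n.+1 = 0 by move: tj; rewrite (find _ _ f0)// eqxx.
rewrite /comb (eq_bigr (fun l : 'I_n.+1 => \sum_(i < n) (t l * c l i) *: v i)).
  rewrite exchange_big big1// => i _.
  by rewrite -scaler_suml tP// scale0r.
by move=> l _; rewrite cP scaler_sumr; apply: eq_bigr => i _; rewrite scalerA.
Qed.

Definition linear_on Z (g : X -> K) : Prop :=
  forall c x y, Z x -> Z y -> g (c *: x + y) = c * g x + g y.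

Lemma submod_closedP Z : GRing.submod_closed (mem Z) <->
  Z 0 /\ forall c x y, Z x -> Z y -> Z (c *: x + y).
Proof.
split=> [[Z0 ZP]|[Z0 ZP]]; split; rewrite ?inE//.
- by move: Z0; rewrite inE.
- move=> c x y Zx Zy; have := ZP c x y; rewrite !inE; exact.
- by move=> c x y; rewrite !inE; apply: ZP.
Qed.

(** The kernel has codimension at most one: a vector y with g y != 0 spans Z
    together with it. *)
Lemma finite_dim_kernel Z g : GRing.submod_closed (mem Z) -> linear_on Z g ->
  finite_dimensional (Z `&` [set x | g x = 0]) -> finite_dimensional Z.
Proof.
move=> /submod_closedP[Z0 ZP] glin [n [v [Zv span]]].
have [[y Zy gy]|no] := pselect (exists2 y, Z y & g y != 0); last first.
  exists n, v; split=> [i|x Zx]; first by case: (Zv i).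
  apply: span; split=> //=; apply/eqP/negPn/negP => gx.
  by apply: no; exists x.
exists n.+1, (fun i => if unlift ord0 i is Some j then v j else y).
split=> [i|x Zx]; first by case: unliftP => [j|] _ //; case: (Zv j).
have [|c xE] := span (- (g x / g y) *: y + x).
  by split; [apply: ZP | rewrite /= glin// mulNr divfK// addNr].
exists (fun i => if unlift ord0 i is Some j then c j else g x / g y).
rewrite big_ord_recl unlift_none.
under eq_bigr do rewrite liftK.
by rewrite -xE addrA scaleNr subrr add0r.
Qed.

Lemma exists_kernel Z (g : nat -> X -> K) m :
  GRing.submod_closed (mem Z) -> (forall i, linear_on Z (g i)) ->
  ~ finite_dimensional Z ->
  exists y, [/\ Z y, y != 0 & forall i, (i < m)%N -> g i y = 0].
Proof.
move=> Zs glin Zinf; pose Zm m := Z `&` [set x | forall i, (i < m)%N -> g i x = 0].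
have /submod_closedP[Z0 ZP] := Zs.
have ZmS n : GRing.submod_closed (mem (Zm n)).
  apply/submod_closedP; split.
    split=> // i _; have := glin i (-1) 0 0 Z0 Z0.
    by rewrite scaler0 addr0 mulN1r addNr.
  move=> c x y [Zx gx] [Zy gy]; split=> [|i ilt]; first exact: ZP.
  by rewrite glin// gx// gy// mulr0 addr0.
have Zminf n : ~ finite_dimensional (Zm n).
  elim: n => [|n IH] fin.
    by apply: Zinf; congr (finite_dimensional _): fin; apply/seteqP; split=> x // -[].
  apply: IH; apply: (@finite_dim_kernel _ (g n)) => //.
    by move=> c x y [Zx _] [Zy _]; apply: glin.
  congr (finite_dimensional _): fin; apply/seteqP; split=> [x [Zx gx]|x [[Zx gx] /= gnx]].
    by split; [split=> // i ilt; apply/gx/ltnW | apply: gx].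
  split=> // i; rewrite ltnS leq_eqVlt => /orP[/eqP ->//|]; exact: gx.
apply: contrapT => no; apply: (Zminf m).
have v0 : 'I_0 -> X by case.
exists 0%N, v0; split=> [[]//|x [Zx gx]]; exists (fun=> 0).
rewrite big_ord0; apply/eqP/negPn/negP => x0; apply: no.
by exists x; split=> //; apply/eqP.
Qed.

End FiniteDimension.

(** * Basic sequences *)

Section BasicSequences.
Context {R : realType} {K : numFieldType} {k : fieldType}.
Variable S : scalars R K k.
Context {X : normedModType K}.
Implicit Types (e : nat -> X) (a b : nat -> K) (C : R) (p q : {poly k}) (z : nat -> {poly k}).

Definition basic C e : Prop := (forall n, e n != 0) /\
  forall a m n, (m <= n)%N -> nrm S (comb e a m) <= C * nrm S (comb e a n).

Definition expansion e a x : Prop := tends S (comb e a) x.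

(** When e is basic this is the closed linear span of the e i with T i. *)
Definition span_on e (T : pred nat) : set X :=
  [set x | exists2 a, expansion e a x & forall i, ~~ T i -> a i = 0].

Lemma expansion_comb e a n :
  expansion e (fun i => if (i < n)%N then a i else 0) (comb e a n).
Proof.
move=> d d0; exists n => m nm.
by rewrite comb_trunc// subrr nrm0 ltW.
Qed.

Lemma expansionP e c a b x y : expansion e a x -> expansion e b y ->
  expansion e (fun i => c * a i + b i) (c *: x + y).
Proof.
move=> ax bye d d0; have d20 : 0 < d / 2 by lra.
have c0 : 0 < nrm S c + 1 by rewrite ltr_wpDl// nrm_ge0.
have [N aN] := ax _ (divr_gt0 d20 c0); have [M bM] := bye _ d20.
exists (maxn N M) => n; rewrite geq_max => /andP[/aN + /bM].
rewrite ler_pdivlMr// => aNn bMn.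
rewrite combP opprD addrACA -scalerBr (le_trans (nrmD _ _ _))// nrmZ.
have := nrm_ge0 S (comb e a n - x); nra.
Qed.

Lemma expansionB e a b x y : expansion e a x -> expansion e b y ->
  expansion e (fun i => a i - b i) (x - y).
Proof.
move=> ax bye; have := expansionP (-1) bye ax.
rewrite scaleN1r [- y + x]addrC; congr (expansion e _ _).
by apply/funext => i; rewrite mulN1r addrC.
Qed.

Section Basic.
Variables (C : R) (e : nat -> X).
Hypothesis be : basic C e.

Lemma basic_nrm_gt0 i : 0 < nrm S (e i).
Proof. by rewrite nrm_gt0; case: be. Qed.

Lemma basic_const_ge1 : 1 <= C.
Proof.
have := be.2 (fun=> 1) _ _ (leqnn 1).
rewrite combS comb0 add0r scale1r -ler_pdivrMr ?basic_nrm_gt0//.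
by rewrite divff// gt_eqF ?basic_nrm_gt0.
Qed.

Lemma expansion_bound a x n : expansion e a x ->
  nrm S (comb e a n) <= C * nrm S x.
Proof.
move=> ax; have C1 := basic_const_ge1.
apply/ler_addgt0Pl => d d0; have [N aN] := ax _ (divr_gt0 d0 (lt_le_trans ltr01 C1)).
have := aN _ (leq_maxl N n); rewrite ler_pdivlMr; last by lra.
have := be.2 a _ _ (leq_maxr N n).
have := nrm_sub S (comb e a (maxn N n)) x; nra.
Qed.

Lemma expansion_coef a x i : expansion e a x ->
  nrm S (a i) * nrm S (e i) <= 2 * C * nrm S x.
Proof.
move=> ax; rewrite -nrmZ; have -> : a i *: e i = comb e a i.+1 - comb e a i.
  by rewrite combS addrC addKr.
have := expansion_bound i ax; have := expansion_bound i.+1 ax.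
have := nrmB S (comb e a i.+1) (comb e a i); lra.
Qed.

Lemma comb_coef a n i : (i < n)%N ->
  nrm S (a i) * nrm S (e i) <= 2 * C * nrm S (comb e a n).
Proof. by move=> ilt; have := expansion_coef i (expansion_comb e a n); rewrite ilt. Qed.

Lemma expansion0_coef a : expansion e a 0 -> forall i, a i = 0.
Proof.
move=> a0 i; apply/eqP; rewrite -(nrm_eq0 S) eq_le nrm_ge0 andbT.
have := expansion_coef i a0; rewrite nrm0 mulr0 -ler_pdivlMr ?basic_nrm_gt0//.
by rewrite mul0r.
Qed.

Lemma expansion_unique a b x : expansion e a x -> expansion e b x -> a = b.
Proof.
move=> ax bx; apply/funext => i; apply/eqP; rewrite -subr_eq0; apply/eqP.
by apply: (@expansion0_coef (fun i => a i - b i)); rewrite -(subrr x); apply: expansionB.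
Qed.

Lemma expansion_eq0 a x : expansion e a x -> (forall i, a i = 0) -> x = 0.
Proof.
move=> ax a0; apply: (tends_unique ax) => d d0; exists 0%N => n _.
by rewrite comb_eq0// subrr nrm0 ltW.
Qed.

Lemma basic_independent : independent e.
Proof.
move=> n t t0 i ilt; have := expansion_comb e t n; rewrite t0.
by move/expansion0_coef/(_ i); rewrite ilt.
Qed.

(** Vectors approximated by finite combinations have an expansion: by the
    coefficient bound, the coefficients of the approximations converge. *)
Lemma adherent_expansion x :
  adherent S [set y | exists a, expansion e a y] x -> exists a, expansion e a x.
Proof.
move=> xA; have C1 := basic_const_ge1.
have /choice[w wP] : forall j : nat, exists ya : X * (nat -> K),
    expansion e ya.2 ya.1 /\ nrm S (ya.1 - x) <= j.+1%:R^-1.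
  by move=> j; have [|y [a ay] yx] := xA j.+1%:R^-1; [|exists (y, a)].
pose y j := (w j).1; pose a j := (w j).2.
have ay j : expansion e (a j) (y j) by case: (wP j).
have yx : tends S y x.
  move=> d d0; pose N := Num.truncn d^-1; exists N => n Nn.
  have [_ /le_trans] := wP n; apply; rewrite invf_ple ?posrE//.
  apply/ltW/(lt_le_trans (truncnS_gt _)); rewrite ler_nat; exact: Nn.
have yc d : 0 < d -> exists N, forall m n, (N <= m)%N -> (N <= n)%N ->
    nrm S (y m - y n) <= d.
  move=> d0; have d20 : 0 < d / 2 by lra.
  have [N yN] := yx _ d20; exists N => m n /yN ym /yN yn.
  have := nrm_dist S x (y m) (y n); rewrite (nrm_distC S x (y n)); lra.
have /choice[l al] : forall i, exists l, tends S (a ^~ i) l.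
  move=> i; apply: scalar_cauchy => d d0; have ei := basic_nrm_gt0 i.
  have [|N yN] := yc (d * nrm S (e i) / (2 * C)).
    by rewrite divr_gt0 ?mulr_gt0//; lra.
  exists N => m n Nm Nn; have := yN _ _ Nm Nn.
  rewrite ler_pdivlMr; last by lra.
  have := expansion_coef i (expansionB (ay m) (ay n)).
  by move=> h1 h2; rewrite -(ler_pM2r ei); lra.
exists l => d d0.
have d4 : 0 < d / (4 * C) by rewrite divr_gt0//; lra.
have [N yN] := yc _ d4; have d20 : 0 < d / 4 by lra.
have [M yM] := yx _ d20; pose p := maxn N M.
have [Q aQ] := ay p _ d20; exists Q => n Qn.
have lp : nrm S (comb e l n - comb e (a p) n) <= d / 4.
  apply: (@tends_nrm_le _ _ _ S _ (fun m => comb e (a m) n - comb e (a p) n)).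
    move=> d' d'0; have [N' aN'] := tends_comb e n al d'0; exists N' => m N'm.
    by rewrite opprB addrA subrK aN'.
  exists N => m Nm; rewrite -combB.
  apply: le_trans (expansion_bound n (expansionB (ay m) (ay p))) _.
  have := yN _ _ Nm (leq_maxl N M); rewrite ler_pdivlMr; lra.
have := nrm_dist S (comb e (a p) n) (comb e l n) x.
have := nrm_dist S (y p) (comb e (a p) n) x.
have := aQ _ Qn; have := yM _ (leq_maxr N M); rewrite -/p; lra.
Qed.

Lemma span_on_mem (T : pred nat) i : T i -> span_on e T (e i).
Proof.
move=> Ti; exists (fun j => (j == i)%:R).
  by move=> d d0; exists i.+1 => n ni; rewrite comb_delta// subrr nrm0 ltW.
by move=> j; apply: contraNeq; case: (eqVneq j i) => [->//|_]; rewrite eqxx.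
Qed.

Lemma span_on_submod (T : pred nat) : GRing.submod_closed (mem (span_on e T)).
Proof.
apply/submod_closedP; split.
  exists (fun=> 0) => // d d0; exists 0%N => n _.
  by rewrite comb_eq0// subrr nrm0 ltW.
move=> c x y [a ax aT] [b bye bT]; exists (fun i => c * a i + b i).
  exact: expansionP.
by move=> i Ti; rewrite aT// bT// mulr0 addr0.
Qed.

Lemma span_on_closed (T : pred nat) : closed (span_on e T).
Proof.
apply: (closed_adherent (S := S)) => x xT.
have [|a ax] := @adherent_expansion x.
  by move=> d /xT[y [b bye _] yx]; exists y => //; exists b.
exists a => // i Ti; apply: (@nrm_small _ _ _ S) => d d0.
have ei := basic_nrm_gt0 i; have C1 := basic_const_ge1.
have [|y [b bye bT] yx] := xT (d * nrm S (e i) / (2 * C)).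
  by rewrite divr_gt0 ?mulr_gt0//; lra.
move: yx; rewrite ler_pdivlMr; last by lra.
have := expansion_coef i (expansionB ax bye).
rewrite bT// subr0 (nrm_distC S x) => h1 h2.
by rewrite -(ler_pM2r ei); lra.
Qed.

Lemma span_on_subspace (T : pred nat) (s : nat -> nat) :
  injective s -> (forall n, T (s n)) -> banach_subspace (span_on e T).
Proof.
move=> sI Ts; split; [exact: span_on_submod | exact: span_on_closed |].
have ind : independent (e \o s).
  move=> n t t0 i ilt; pose t' j := \sum_(l < n | s l == j) t l.
  pose M := (\max_(l < n) s l).+1.
  have sM (l : 'I_n) : (s l < M)%N by rewrite ltnS (leq_bigmax l).
  have : comb e t' M = 0.
    rewrite -t0 /comb /t' /=.
    transitivity (\sum_(j < M) \sum_(l < n | s l == j) t l *: e (s l)).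
      apply: eq_bigr => j _; rewrite scaler_suml; apply: eq_bigr => l /eqP ->//.
    rewrite (exchange_big_dep xpredT)//=; apply: eq_bigr => l _.
    by rewrite (big_pred1 (Ordinal (sM l)))// => j; rewrite eq_sym.
  move/basic_independent/(_ (s i) (sM (Ordinal ilt))).
  rewrite /t' (big_pred1 (Ordinal ilt))// => l.
  by rewrite (inj_eq sI).
by apply: (independent_infinite_dim ind) => n; apply: span_on_mem.
Qed.

End Basic.

(** ** Block sequences *)

(** The vector encoded by p, of which p lists the coefficients along e. *)
Definition realize e (p : {poly k}) : X :=
  comb e (fun i => lift_k S p`_i) (size p).

Lemma realizeE e p n : (size p <= n)%N ->
  realize e p = comb e (fun i => lift_k S p`_i) n.
Proof.
move=> pn; rewrite /realize [RHS](comb_widen _ pn)// => i pi.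
by rewrite nth_default// rmorph0.
Qed.

Lemma realizeP e (a : k) p q :
  realize e (a *: p + q) = lift_k S a *: realize e p + realize e q.
Proof.
pose n := maxn (size (a *: p + q)) (maxn (size p) (size q)).
rewrite !(@realizeE e _ n) ?leq_max ?leqnn ?orbT//= -combP.
by apply: eq_comb => i _; rewrite coefD coefZ rmorphD rmorphM.
Qed.

Lemma realize0 e : realize e 0 = 0.
Proof. by rewrite /realize size_poly0 comb0. Qed.

Lemma realizeZ e (a : k) p : realize e (a *: p) = lift_k S a *: realize e p.
Proof. by rewrite -[a *: p]addr0 realizeP realize0 addr0. Qed.

Lemma realizeD e p q : realize e (p + q) = realize e p + realize e q.
Proof. by rewrite -[p]scale1r realizeP rmorph1 !scale1r. Qed.

Lemma realize_comb e z (c : nat -> k) n :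
  realize e (comb z c n) = comb (realize e \o z) (lift_k S \o c) n.
Proof.
elim: n => [|n IH]; first by rewrite !comb0 realize0.
by rewrite !combS realizeD realizeZ IH.
Qed.

Lemma realize_combine e z p : realize e (combine z p) = realize (realize e \o z) p.
Proof. by rewrite /combine realize_comb. Qed.

(** A partial sum over blocks is a partial sum over e, cut at the end of a
    block, so the constant is inherited. *)
Lemma basic_block C e z : basic C e -> block z -> basic C (realize e \o z).
Proof.
move=> be bz; pose N m := if m is m'.+1 then size (z m') else 0%N.
have Nmono m n : (m <= n)%N -> (N m <= N n)%N.
  by case: m n => [|m] [|n]//=; rewrite ltnS; exact: block_size_mono.
pose b a n j := \sum_(i < n) a i * lift_k S (z i)`_j.
have combE a m n : (m <= n)%N ->
    comb (realize e \o z) a m = comb e (b a n) (N m).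
  move=> mn.
  transitivity (\sum_(i < n) a i *: comb e (fun j => lift_k S (z i)`_j) (N m)); last first.
    rewrite /comb /b; under eq_bigr do rewrite scaler_sumr.
    rewrite exchange_big; apply: eq_bigr => j _; rewrite scaler_suml.
    by apply: eq_bigr => i _; rewrite scalerA.
  rewrite -(@comb_trunc _ _ _ _ m n)// /comb; apply: eq_bigr => i _ /=.
  have [im|mi] := ltnP i m.
    congr (_ *: _); apply: realizeE.
    by case: m im {mn} => // m; rewrite ltnS; exact: block_size_mono.
  rewrite scale0r -/(comb e (fun j => lift_k S (z i)`_j) (N m)).
  rewrite comb_eq0 ?scaler0// => j jN.
  case: m {mn} mi jN => // m mi jN.
  by rewrite (block_tail_size bz mi jN) rmorph0.
split=> [i|a m n mn]; last first.
  by rewrite (combE a m n)// (combE a n n)//; apply: be.2; exact: Nmono.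
apply/eqP => /= zi0; have [+ _] := bz i; rewrite -lead_coef_eq0.
have sz : (0 < size (z i))%N by exact: leq_ltn_trans (block_size_ge bz i).
have := basic_independent be zi0 (i := (size (z i)).-1).
by rewrite prednK// -lead_coefE -(fmorph_eq0 (lift_k S)) => ->//; rewrite eqxx.
Qed.

End BasicSequences.

(** * Existence of basic sequences *)

(** Dependent choice, where a term may depend on all the previous ones. *)
Lemma sequence_choice (T : Type) (x0 : T) (Q : nat -> (nat -> T) -> T -> Prop) :
  (forall n f g x, (forall i, (i < n)%N -> f i = g i) -> Q n f x -> Q n g x) ->
  (forall n f, (forall i, (i < n)%N -> Q i f (f i)) -> exists x, Q n f x) ->
  exists f, forall n, Q n f (f n).
Proof.
move=> Qext Qex.
have /choice[F FP] : forall nf : nat * (nat -> T), exists x,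
    (forall i, (i < nf.1)%N -> Q i nf.2 (nf.2 i)) -> Q nf.1 nf.2 x.
  move=> [n f] /=; have [fQ|no] := pselect (forall i, (i < n)%N -> Q i f (f i)).
    by have [x Qx] := Qex n f fQ; exists x.
  by exists x0.
pose s := fix s n := if n is m.+1 then rcons (s m) (F (m, nth x0 (s m))) else [::].
pose f n := nth x0 (s n.+1) n.
have ss n : size (s n) = n by elim: n => //= n IH; rewrite size_rcons IH.
have sf n i : (i < n)%N -> nth x0 (s n) i = f i.
  elim: n => // n IH; rewrite ltnS leq_eqVlt => /orP[/eqP ->//|ilt].
  by rewrite /= nth_rcons ss ilt IH.
have fE n : f n = F (n, nth x0 (s n)) by rewrite /f /= nth_rcons ss ltnn eqxx.
exists f => n; elim/ltn_ind: n => n IH.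
apply: (@Qext _ (nth x0 (s n))); first by move=> i /sf.
rewrite fE; apply: (FP (n, _)) => i /= ilt; rewrite sf//.
apply: (@Qext _ f); last exact: IH.
by move=> j ji; rewrite sf// (ltn_trans ji).
Qed.

Lemma pigeonhole (T : finType) (f : nat -> T) :
  exists n m, (n < m)%N /\ f n = f m.
Proof.
apply: contrapT => no.
have fI : injective (fun i : 'I_#|T|.+1 => f i).
  move=> i j fij; apply/val_inj; have [ij|ji|//] := ltngtP (i : nat) j.
    by case: no; exists i, j.
  by case: no; exists j, i.
by have := leq_card _ fI; rewrite card_ord ltnn.
Qed.

Section ExistsBasic.
Context {R : realType} {K : numFieldType} {k : fieldType}.
Variable S : scalars R K k.
Context {X : normedModType K}.
Local Notation N := (nrm S).
Local Notation emb := (emb S).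

(** ** Riesz sequences *)

(** A vector that may follow r 0, ..., r (n - 1) in a bounded sequence whose
    terms are uniformly far from the span of their predecessors. *)
Definition riesz_next n (r : nat -> X) (x : X) : Prop :=
  N x <= 1 /\ forall a, 1 / 2 <= N (x - comb r a n).

(** The distance condition bounds the last coefficient, which may then be
    subtracted. *)
Lemma riesz_coef n (r : nat -> X) : (forall i, (i < n)%N -> riesz_next i r (r i)) ->
  exists2 M : R, 0 <= M & forall a i, (i < n)%N -> N (a i) <= M * N (comb r a n).
Proof.
elim: n => [|n IH] rP; first by exists 0.
have [|M M0 MP] := IH; first by move=> i ilt; apply/rP/ltnW.
have [rn1 rn2] := rP _ (ltnSn n).
exists (3 * M + 2); first by lra.
move=> a i; rewrite combS; set s := comb r a n; set x := s + _.
have an : N (a n) <= 2 * N x.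
  have [->|an0] := eqVneq (a n) 0; first by rewrite nrm0 mulr_ge0// nrm_ge0.
  have -> : x = a n *: (r n - comb r (fun i => - (a n)^-1 * a i) n).
    rewrite combZ scalerBr scalerA mulrN divff//.
    by rewrite scaleN1r opprK addrC.
  by rewrite nrmZ; have := rn2 (fun i => - (a n)^-1 * a i); have := nrm_ge0 S (a n); nra.
have sn : N s <= 3 * N x.
  have -> : s = x - a n *: r n by rewrite addrK.
  apply: le_trans (nrmB _ _ _) _; rewrite nrmZ.
  have := nrm_ge0 S (a n); nra.
have := nrm_ge0 S x.
rewrite ltnS leq_eqVlt => x0 /orP[/eqP ->|ilt]; first nra.
by have := MP a i ilt; rewrite -/s; nra.
Qed.

(** By the coefficient bound the span of finitely many terms is closed, hence
    at a positive distance from some vector; subtract from the latter an almost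
    nearest point of the span, and normalize. *)
Lemma exists_riesz : infinite_dimensional X ->
  exists r : nat -> X, forall n, riesz_next n r (r n).
Proof.
move=> Xinf; apply: (@sequence_choice _ 0).
  by move=> n f g x fg [x1 xP]; split=> // a; rewrite -(_ : comb f a n = comb g a n)//;
    apply: eq_bigr => i _; rewrite fg.
move=> n r rP; have [M M0 MP] := riesz_coef rP.
have [x xP] : exists x, forall a, x <> comb r a n.
  apply: contrapT => no; apply: Xinf; exists n, (fun i : 'I_n => r i); split=> // x _.
  apply: contrapT => nox; apply: no; exists x => a xE; apply: nox.
  by exists (fun i => a i).
have [d d0 dP] : exists2 d, 0 < d & forall a, d <= N (x - comb r a n).
  apply: contrapT => no.
  have /choice[a aP] : forall j : nat, exists a, N (x - comb r a n) < j.+1%:R^-1.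
    move=> j; apply: contrapT => noj; apply: no; exists j.+1%:R^-1 => // a.
    by rewrite leNgt; apply/negP => h; apply: noj; exists a.
  have ax : tends S (fun j => comb r (a j) n) x.
    move=> d d0; exists (Num.truncn d^-1) => j Nj; rewrite nrm_distC.
    apply: (le_trans (ltW (aP j))); rewrite invf_ple ?posrE//.
    by apply/ltW/(lt_le_trans (truncnS_gt _)); rewrite ler_nat; exact: Nj.
  have /choice[l lP] : forall i, exists l, (i < n)%N -> tends S (a ^~ i) l.
    move=> i; have [ilt|_] := ltnP i n; last by exists 0.
    suff [l al] : exists l, tends S (a ^~ i) l by exists l.
    apply: scalar_cauchy => d d0; have M1 : 0 < M + 1 by lra.
    have d2 : 0 < d / 2 / (M + 1) by rewrite !divr_gt0.
    have [Q aQ] := ax _ d2; exists Q => p q /aQ + /aQ.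
    rewrite !ler_pdivlMr// => ap aq.
    have := MP (fun i => a p i - a q i) _ ilt; rewrite combB.
    have := nrm_dist S x (comb r (a p) n) (comb r (a q) n).
    rewrite (nrm_distC S x).
    have := nrm_ge0 S (comb r (a p) n - comb r (a q) n).
    have := nrm_ge0 S (comb r (a p) n - x).
    have := nrm_ge0 S (comb r (a q) n - x); nra.
  apply: (xP (fun i => if (i < n)%N then l i else 0)).
  apply: (tends_unique ax).
  have := @tends_comb _ _ _ S _ r (fun m i => if (i < n)%N then a m i else 0)
    (fun i => if (i < n)%N then l i else 0) n.
  rewrite (_ : (fun m => comb r _ n) = (fun m => comb r (a m) n)); last first.
    by apply/funext => m; apply: eq_comb => i ->.
  apply=> i; have [/lP//|_] := ltnP i n => e e0.
  by exists 0%N => m _; rewrite subrr nrm0 ltW.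
pose A := [set N (x - comb r a n) | a in [set: nat -> K]].
have Ainf : has_inf A.
  split; first by exists (N (x - comb r (fun=> 0) n)), (fun=> 0).
  by exists d => _ [a _ <-].
have D0 : 0 < inf A.
  apply: (lt_le_trans d0); apply: lb_le_inf; first by case: Ainf.
  by move=> _ [a _ <-].
have [_ [a _ <-] aD] := inf_adherent D0 Ainf.
pose y := x - comb r a n; have y0 : 0 < N y by exact: lt_le_trans d0 (dP a).
have Niy : N (emb (N y)^-1) = (N y)^-1 by rewrite nrm_emb// invr_ge0 ltW.
exists (emb (N y)^-1 *: y); split; first by rewrite nrmZ Niy mulVf// gt_eqF.
move=> b.
have -> : emb (N y)^-1 *: y - comb r b n =
    emb (N y)^-1 *: (x - comb r (fun i => emb (N y) * b i + a i) n).
  rewrite combP /y !scalerBr scalerDr scalerA -rmorphM mulVf ?gt_eqF//.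
  by rewrite rmorph1 scale1r opprD addrA addrAC.
rewrite nrmZ Niy [_^-1 * _]mulrC ler_pdivlMr//.
have : inf A <= N (x - comb r (fun i => emb (N y) * b i + a i) n).
  by apply: ge_inf; [case: Ainf | exists (fun i => emb (N y) * b i + a i)].
by move: aD; rewrite -/y; lra.
Qed.

(** ** Differences nearly orthogonal to a finite dimensional subspace *)

Section Mazur.
Variable r : nat -> X.
Hypothesis rP : forall n, riesz_next n r (r n).

Definition drifts (y : X) n : set R :=
  [set N (y *+ s - r n) - N y *+ s | s in [set: nat]].

(** The one-sided derivative of the norm at y in the direction - r n. It plays
    the role of the value at - r n of a functional norming y, and is used only
    through the subadditivity expressed by potential_drop. *)
Definition potential (y : X) n : R := inf (drifts y n).

Lemma drifts_lb y n : lbound (drifts y n) (-1).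
Proof.
move=> _ [s _ <-]; have [rn _] := rP n.
have := nrm_sub S (y *+ s) (y *+ s - r n).
by rewrite subKr nrm_nat; lra.
Qed.

Lemma has_inf_drifts y n : has_inf (drifts y n).
Proof.
split; last by exists (-1); exact: drifts_lb.
by exists (N (y *+ 0 - r n) - N y *+ 0), 0%N.
Qed.

Lemma potential_ge y n : -1 <= potential y n.
Proof. by apply: lb_le_inf; [case: (has_inf_drifts y n) | exact: drifts_lb]. Qed.

Lemma potential_le y n : potential y n <= 1.
Proof.
have [rn _] := rP n; apply: (@le_trans _ _ (N (r n))) => //.
apply: ge_inf; first by case: (has_inf_drifts y n).
by exists 0%N => //; rewrite !mulr0n sub0r nrmN subr0.
Qed.

Lemma potential_drop y n m d :
  N (y + (r n - r m)) <= N y - d -> potential y m <= potential y n - d.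
Proof.
move=> yd; rewrite lerBrDr; apply: lb_le_inf; first by case: (has_inf_drifts y n).
move=> _ [s _ <-]; rewrite -lerBrDr.
apply: (@le_trans _ _ (N (y *+ s.+1 - r m) - N y *+ s.+1)).
  by apply: ge_inf; [case: (has_inf_drifts y m) | exists s.+1].
have -> : y *+ s.+1 - r m = (y *+ s - r n) + (y + (r n - r m)).
  by rewrite mulrSr [RHS]addrACA addKr.
have := nrmD S (y *+ s - r n) (y + (r n - r m)).
rewrite mulrSr; lra.
Qed.

(** Bounded potentials cannot drop along every pair, so some difference
    r n - r m almost fails to shorten each vector of a finite list. *)
Lemma exists_long_pair (L : seq X) (d : R) M : 0 < d ->
  exists n m, [/\ (M <= n)%N, (n < m)%N &
    forall y, y \in L -> N y - d <= N (y + (r n - r m))].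
Proof.
move=> d0; pose B := Num.truncn (2 / d).
pose c y n := Num.truncn ((potential y (M + n)%N + 1) / d).
have c0 y n : 0 <= (potential y (M + n)%N + 1) / d.
  by apply: divr_ge0 (ltW d0); have := potential_ge y (M + n)%N; lra.
have cB y n : (c y n < B.+1)%N.
  rewrite ltnS; apply: le_truncn; rewrite ler_pM2r ?invr_gt0//.
  by have := potential_le y (M + n)%N; lra.
have [n [m [nm fnm]]] :=
  @pigeonhole _ (fun n => [ffun i : 'I_(size L) => Ordinal (cB (nth 0 L i) n)]).
exists (M + n)%N, (M + m)%N; split; rewrite ?leq_addr ?ltn_add2l// => y yL.
have cnm : c y n = c y m.
  have ilt : (index y L < size L)%N by rewrite index_mem.
  move/ffunP/(_ (Ordinal ilt)): fnm; rewrite !ffunE => /(congr1 val) /=.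
  by rewrite nth_index.
rewrite leNgt; apply/negP => /ltW /potential_drop drop.
have /andP[_ +] := truncn_itv (c0 y n); have /andP[+ _] := truncn_itv (c0 y m).
rewrite -/(c y n) -/(c y m) cnm ler_pdivlMr// ltr_pdivrMr// -natr1; lra.
Qed.

Lemma riesz_sep a n m : (n < m)%N -> 1 / 2 <= N (comb r a n + (r n - r m)).
Proof.
move=> nm; have [_] := rP m; pose b i := if (i < n)%N then a i else (i == n)%:R.
move=> /(_ b); rewrite nrm_distC; suff -> : comb r b m = comb r a n + r n.
  by rewrite addrA.
rewrite (@comb_widen _ _ _ _ n.+1)//; last first.
  by move=> i ni; rewrite /b ltnNge (ltnW ni) gtn_eqF.
rewrite combS /b ltnn eqxx scale1r; congr (_ + _).
by apply: eq_comb => i ->.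
Qed.

(** Mazur: long vectors of the subspace cannot be shortened much by a bounded
    perturbation, short ones are shorter than the distance of the perturbation
    to the subspace, and those in between are handled by a finite net. *)
Lemma exists_nearly_orthogonal M (d : R) : 0 < d -> exists n m,
  [/\ (M <= n)%N, (n < m)%N, r n - r m != 0 & forall a (t : K),
    N (comb r a M) <= (1 + d) * N (comb r a M + t *: (r n - r m))].
Proof.
move=> d0; pose rho := 2 * (1 + d) / d.
have rho0 : 0 < rho by rewrite divr_gt0//; lra.
have rhod : rho * d = 2 * (1 + d) by rewrite /rho divfK ?gt_eqF.
pose h := d / (6 * (1 + d)).
have h0 : 0 < h by rewrite divr_gt0//; lra.
have hd : h * (6 * (1 + d)) = d by rewrite /h divfK// gt_eqF//; lra.
have [C C0 CP] := @riesz_coef M r (fun i _ => rP i).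
have [L LP] := comb_net S r M (C * rho) h0.
have [n [m [Mn nm nmP]]] := exists_long_pair L M h0.
have sep a : 1 / 2 <= N (comb r a M + (r n - r m)).
  by rewrite -(comb_trunc _ a Mn); exact: riesz_sep.
exists n, m; split=> //.
  rewrite -(nrm_gt0 S); have := riesz_sep (fun=> 0) nm.
  by rewrite comb_eq0// add0r; lra.
have main a : N (comb r a M) <= (1 + d) * N (comb r a M + (r n - r m)).
  set y := comb r a M; set x := r n - r m.
  have [short|long] := leP (N y) (1 / 2).
    by have := sep a; rewrite -/y -/x; nra.
  have [yrho|rhoy] := leP (N y) rho; last first.
    have [rn _] := rP n; have [rm _] := rP m.
    have := nrmB S (y + x) x; rewrite addrK.
    by have := nrmB S (r n) (r m); rewrite -/x; nra.
  have [|y' y'L yy'] := LP a.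
    by move=> i ilt; apply: le_trans (CP a i ilt) _; rewrite ler_wpM2l.
  have := nmP _ y'L; rewrite -/x -/y in yy' *.
  have := nrm_sub S y y'.
  have := nrm_sub S (y' + x) (y + x); rewrite opprD addrACA subrr addr0.
  by rewrite (nrm_distC S y'); nra.
move=> a t; have [->|t0] := eqVneq t 0.
  by rewrite scale0r addr0; have := nrm_ge0 S (comb r a M); nra.
have -> : comb r a M = t *: comb r (fun i => t^-1 * a i) M.
  by rewrite combZ scalerA divff// scale1r.
rewrite -scalerDr !nrmZ mulrCA ler_wpM2l ?nrm_ge0//; exact: main.
Qed.

End Mazur.

(** Each new term distorts the norm of the previous combinations by a factor
    c (j + 1) / c j; as c increases from 1 and stays below 2, the product of
    these factors is at most 2. *)
Theorem exists_basic : infinite_dimensional X -> exists e : nat -> X, basic S 2 e.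
Proof.
move=> /exists_riesz[r rP].
pose c (j : nat) : R := 2 - j.+1%:R^-1.
have cS j : c j < c j.+1.
  by rewrite /c ltrD2l ltrN2 ltf_pV2 ?posrE// ltr_nat.
have c1 j : 1 <= c j.
  by rewrite /c lerBrDr -lerBrDl (_ : 2 - 1 = 1); [rewrite invf_le1// ler1n|lra].
have c2 j : c j <= 2 by rewrite /c lerBlDr lerDl invr_ge0.
pose d j := c j.+1 / c j - 1.
have d0 j : 0 < d j.
  by rewrite /d subr_gt0 ltr_pdivlMr ?mul1r//; exact: lt_le_trans (c1 j).
have /choice[F FP] : forall Mj : nat * nat, exists nm : nat * nat,
    [/\ (Mj.1 <= nm.1)%N, (nm.1 < nm.2)%N, r nm.1 - r nm.2 != 0 & forall a (t : K),
      N (comb r a Mj.1) <=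
        (1 + d Mj.2) * N (comb r a Mj.1 + t *: (r nm.1 - r nm.2))].
  move=> [M j]; have [n [m [h1 h2 h3 h4]]] := exists_nearly_orthogonal rP M (d0 j).
  by exists (n, m).
pose M := fix M j := if j is i.+1 then (F (M i, i)).2.+1 else 0%N.
pose e j := r (F (M j, j)).1 - r (F (M j, j)).2.
have MS j : M j.+1 = (F (M j, j)).2.+1 by [].
have spanM a j : exists b, comb e a j = comb r b (M j).
  elim: j => [|j [b IH]]; first by exists (fun=> 0); rewrite !comb0.
  have [/= Mn nm _ _] := FP (M j, j).
  pose n := (F (M j, j)).1; pose m := (F (M j, j)).2.
  have rn : r n = comb r (fun i => (i == n)%:R) (M j.+1).
    by rewrite comb_delta// MS ltnS ltnW.
  have rm : r m = comb r (fun i => (i == m)%:R) (M j.+1) by rewrite comb_delta// MS.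
  exists (fun i => a j * ((i == n)%:R - (i == m)%:R) +
                   (if (i < M j)%N then b i else 0)).
  rewrite combS combP combB -rn -rm comb_trunc -?IH 1?addrC//.
  by rewrite (leq_trans Mn)// ltnW// ltnS ltnW.
exists e; split=> [j|a]; first by have [] := FP (M j, j).
have step j : c j * N (comb e a j) <= c j.+1 * N (comb e a j.+1).
  have [b bE] := spanM a j; have [_ _ _ /(_ b (a j))] := FP (M j, j).
  have cj : 0 < c j by exact: lt_le_trans (c1 j).
  rewrite combS -bE /= /d addrC subrK -/(e j) [c j.+1 / _]mulrC -mulrA.
  by rewrite ler_pdivlMl.
have mono i j : (i <= j)%N -> c i * N (comb e a i) <= c j * N (comb e a j).
  move=> /subnKC <-; elim: (j - i)%N => [|l IH]; first by rewrite addn0.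
  by rewrite addnS; apply: le_trans IH _.
move=> i j ij; have := mono i j ij; have := c1 i; have := c2 j.
have := nrm_ge0 S (comb e a i); have := nrm_ge0 S (comb e a j); nra.
Qed.

End ExistsBasic.

(** * Unconditional basic sequences *)

Section Unconditional.
Context {R : realType} {K : numFieldType} {k : fieldType}.
Variable S : scalars R K k.
Context {X : normedModType K}.
Local Notation N := (nrm S).
Implicit Types (e : nat -> X) (a : nat -> K) (A : pred nat).

(** Bounded coordinate projections: the quantitative form of
    unconditionality. *)
Definition suppression (D : R) e : Prop := forall a n A,
  N (\sum_(i < n | A i) a i *: e i) <= D * N (comb e a n).

Lemma series_comb e a : series (fun n => a n *: e n) = comb e a.
Proof. by apply/funext => n; rewrite /series /= big_mkord. Qed.

Lemma perm_sum (s s' : nat -> nat) (f : nat -> X) n m :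
  cancel s s' -> cancel s' s -> (forall i, (i < n)%N -> (s i < m)%N) ->
  \sum_(i < n) f (s i) = \sum_(j < m | (s' j < n)%N) f j.
Proof.
move=> sK s'K sm; rewrite -(big_mkord xpredT (fun i => f (s i))).
rewrite -(big_mkord (fun j => s' j < n)%N f) -[RHS]big_filter.
rewrite -(big_map s xpredT f); apply: perm_big; apply: uniq_perm.
- by rewrite map_inj_uniq ?iota_uniq//; exact: can_inj sK.
- by rewrite filter_uniq ?iota_uniq.
move=> j; rewrite mem_filter mem_index_iota /=.
apply/mapP/andP => [[l]|[jn jm]].
  by rewrite mem_index_iota /= => ln ->; rewrite sK ln sm.
by exists (s' j); rewrite ?mem_index_iota ?s'K.
Qed.

(** A rearranged partial sum differs from an early partial sum by a
    subsum of a small block of the series. *)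
Lemma suppression_rearrange D e a x (s : nat -> nat) :
  suppression D e -> bijective s -> expansion S e a x ->
  tends S (fun n => \sum_(i < n) a (s i) *: e (s i)) x.
Proof.
move=> sD [s' sK s'K] ax d d0.
have D0 : 0 < `|D| + 1 by rewrite ltr_wpDl.
have d'0 : 0 < d / 2 / (2 * (`|D| + 1)) by rewrite !divr_gt0// mulr_gt0.
have [M aM] := ax _ d'0.
have [M' aM'] := ax _ (divr_gt0 d0 (ltr0Sn R 1)); pose Q := maxn M M'.
exists (\max_(j < Q) s' j).+1 => n Qn.
pose m := maxn Q (\max_(i < n) s i).+1.
rewrite (perm_sum (fun j => a j *: e j) sK s'K (m := m)); last first.
  move=> i ilt; rewrite leq_max ltnS; apply/orP; right.
  exact: (@leq_bigmax _ (fun i : 'I_n => s i) (Ordinal ilt)).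
have s'Q j : (j < Q)%N -> (s' j < n)%N.
  move=> jQ; apply: leq_trans Qn; rewrite ltnS.
  exact: (@leq_bigmax _ (fun i : 'I_Q => s' i) (Ordinal jQ)).
have Qm : (Q <= m)%N by rewrite leq_maxl.
pose b j := a j - (if (j < Q)%N then a j else 0).
have bE : comb e b m = comb e a m - comb e a Q by rewrite combB comb_trunc.
have -> : \sum_(j < m | (s' j < n)%N) a j *: e j =
    comb e a Q + \sum_(j < m | (s' j < n)%N) b j *: e j.
  rewrite -(comb_trunc e a Qm) /comb [X in X + _](bigID (fun j : 'I_m => (s' j < n)%N)) /=.
  rewrite [X in _ + X + _]big1 ?addr0 -?big_split/=.
    by apply: eq_bigr => j _; rewrite -scalerDl subrKC.
  by move=> j; case: ifPn => [/s'Q ->//|_ _]; rewrite scale0r.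
have b1 : N (comb e b m) <= d / 2 / (`|D| + 1).
  rewrite bE; have MQ : (M <= Q)%N by rewrite leq_maxl.
  have := nrm_dist S x (comb e a m) (comb e a Q).
  have := aM _ (leq_trans MQ Qm); have := aM _ MQ.
  rewrite !ler_pdivlMr ?mulr_gt0// (nrm_distC S x); nra.
have b2 : N (\sum_(j < m | (s' j < n)%N) b j *: e j) <= d / 2.
  apply: le_trans (sD b m (fun j => s' j < n)%N) _.
  move: b1; rewrite ler_pdivlMr// => b1.
  by have := ler_norm D; have := nrm_ge0 S (comb e b m); nra.
have := aM' Q (leq_maxr _ _).
rewrite addrAC; have := nrmD S (comb e a Q - x) (\sum_(j < m | (s' j < n)%N) b j *: e j).
by move: b2; lra.
Qed.

Theorem suppression_unconditional C D e : basic S C e -> suppression D e ->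
  exists (Y : set X) (e : nat -> X), banach_subspace Y /\ unconditional_basis Y e.
Proof.
move=> be sD; exists (span_on S e xpredT), e; split.
  exact: (span_on_subspace be (s := id)).
split; first split.
- by move=> n; apply: span_on_mem.
- move=> x [a ax _]; exists a; split; first by rewrite series_comb; apply/(tendsP S).
  move=> b; rewrite series_comb => /(tendsP S) bx.
  exact (expansion_unique be ax bx).
move=> x a _; rewrite series_comb => /(tendsP S) ax s sbij.
have -> : series (fun n => a (s n) *: e (s n)) =
    (fun n => \sum_(i < n) a (s i) *: e (s i)).
  by apply/funext => n; rewrite /series /= big_mkord.
by apply/(tendsP S); apply: suppression_rearrange sD sbij ax.
Qed.

(** ** Signs *)

Definition flip A a i := if A i then a i else - a i.

Lemma comb_flip e a n A :
  comb e (flip A a) n =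
  \sum_(i < n | A i) a i *: e i - \sum_(i < n | ~~ A i) a i *: e i.
Proof.
rewrite /comb (bigID (fun i : 'I_n => A i)) /= -sumrN; congr (_ + _).
  by apply: eq_bigr => i Ai; rewrite /flip Ai.
by apply: eq_bigr => i /negbTE Ai; rewrite /flip Ai scaleNr.
Qed.

Lemma comb_split e a n A :
  comb e a n = \sum_(i < n | A i) a i *: e i + \sum_(i < n | ~~ A i) a i *: e i.
Proof. by rewrite /comb (bigID (fun i : 'I_n => A i)). Qed.

Lemma halves_sum n : \sum_(i < n) (2 ^- i.+1 : R) <= 1.
Proof.
suff -> : \sum_(i < n) (2 ^- i.+1 : R) = 1 - 2 ^- n by rewrite gerBl invr_ge0 exprn_ge0.
elim: n => [|n IH]; first by rewrite big_ord0 expr0 invr1 subrr.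
by rewrite big_ord_recr /= IH exprS invfM; field; rewrite expf_neq0.
Qed.

Lemma comb_close e a (b : nat -> K) n (d : R) : 0 <= d ->
  (forall i, (i < n)%N -> N (a i - b i) * N (e i) <= d * 2 ^- i.+1) ->
  N (comb e a n - comb e b n) <= d.
Proof.
move=> d0 ab; rewrite -combB; apply: le_trans (nrm_sum _ _) _.
apply: (@le_trans _ _ (\sum_(i < n) d * 2 ^- i.+1)).
  by apply: ler_sum => i _; rewrite nrmZ ab.
by rewrite -mulr_sumr -[leRHS]mulr1 ler_wpM2l// halves_sum.
Qed.

(** Changing signs is bounded on all combinations as soon as it is bounded on
    those with coefficients in suitable finite nets, by homogeneity. *)
Lemma nets_suppression C e (G : nat -> seq K) (d : R) :
  basic S C e -> 0 < d <= 1 ->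
  (forall i (t : K), N t * N (e i) <= 2 * C ->
    exists2 q, q \in G i & N (t - q) * N (e i) <= d / 4 * 2 ^- i.+1) ->
  (forall n A c, (forall i, c i \in G i) ->
    d * N (comb e c n) <= N (comb e (flip A c) n)) ->
  suppression (1 / 2 + 1 / d) e.
Proof.
move=> be /andP[d0 d1] netG signG.
have C1 := basic_const_ge1 be.
have d40 : 0 <= d / 4 by lra.
have key a n A : d / 2 * N (comb e a n) <= N (comb e (flip A a) n).
  (* The combination is normalized, and its coefficients rounded into the nets. *)
  have [->|s0] := eqVneq (comb e a n) 0; first by rewrite nrm0 mulr0 nrm_ge0.
  set t := N (comb e a n); have t0 : 0 < t by rewrite nrm_gt0.
  have Nit : N (emb S t^-1) = t^-1 by rewrite nrm_emb// invr_ge0 ltW.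
  pose b i := if (i < n)%N then emb S t^-1 * a i else 0.
  have bE : comb e b n = emb S t^-1 *: comb e a n.
    by rewrite -combZ; apply: eq_comb => i ilt; rewrite /b ilt.
  have Nb : N (comb e b n) = 1 by rewrite bE nrmZ Nit mulVf// gt_eqF.
  have fbE : comb e (flip A b) n = emb S t^-1 *: comb e (flip A a) n.
    rewrite -combZ; apply: eq_comb => i ilt; rewrite /flip /b ilt.
    by case: (A i); rewrite ?mulrN.
  have /choice[c cP] : forall i, exists q, q \in G i /\
      N (b i - q) * N (e i) <= d / 4 * 2 ^- i.+1.
    move=> i; have [|q qG qb] := netG i (b i); last by exists q.
    have [ilt|ni] := ltnP i n; last first.
      by rewrite /b ltnNge ni /= nrm0 mul0r; lra.
    by have := comb_coef be b ilt; rewrite Nb mulr1.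
  have cb : N (comb e b n - comb e c n) <= d / 4.
    by apply: comb_close => // i _; case: (cP i).
  have fcb : N (comb e (flip A b) n - comb e (flip A c) n) <= d / 4.
    apply: comb_close => // i _; rewrite /flip; case: (A i); first by case: (cP i).
    by rewrite -opprD nrmN; case: (cP i).
  have sc := signG n A c (fun i => (cP i).1).
  have : d / 2 <= N (comb e (flip A b) n).
    have := nrm_sub S (comb e b n) (comb e c n).
    have := nrm_sub S (comb e (flip A c) n) (comb e (flip A b) n).
    rewrite nrm_distC Nb; nra.
  by rewrite fbE nrmZ Nit [t^-1 * _]mulrC ler_pdivlMr.
move=> a n A; have := key (flip A a) n A.
rewrite (_ : flip A (flip A a) = a); last first.
  by apply/funext => i; rewrite /flip; case: (A i); rewrite ?opprK.
set s := N (comb e a n); set s' := N _ => ss'.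
have : N (\sum_(i < n | A i) a i *: e i) *+ 2 <= s + s'.
  rewrite -nrm_nat mulr2n /s /s'; set y := \sum_(i < n | A i) _.
  apply: le_trans (nrmD _ _ _); rewrite comb_flip (comb_split e a n A) -/y.
  by rewrite addrACA subrr addr0.
have : s' <= 2 * (d^-1 * s) by rewrite mulrA mulrAC ler_pdivlMr//; lra.
rewrite mulrDl div1r mulr2n; lra.
Qed.

End Unconditional.

(** * The dichotomy in normed spaces *)

Section Dichotomy.
Context {R : realType} {K : numFieldType} {k : fieldType}.
Variable S : scalars R K k.
Context {X : normedModType K}.
Local Notation N := (nrm S).
Local Notation J := (realize S).
Implicit Types (e : nat -> X) (z : nat -> {poly k}).

Definition close_pair (d : R) e (u w : {poly k}) : Prop :=
  N (J e u - J e w) < d * N (J e u + J e w).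

(** No two large subspaces are at a positive angle: this is hereditary
    indecomposability, for subspaces of finite combinations. *)
Definition indecomposable e : Prop := forall (d : R) U W, 0 < d ->
  large U -> large W -> exists u w, [/\ U u, W w & close_pair d e u w].

(** The precision improves with size v, which exceeds the rank of v in any
    block sequence; the errors made on all blocks are thus summable. *)
Lemma exists_scalar_nets e C (d : R) : 0 < d -> exists g : {poly k} -> seq k,
  forall v (t : K), J e v != 0 -> N t * N (J e v) <= 2 * C ->
    exists2 q, q \in g v & N (t - lift_k S q) * N (J e v) <= d * 2 ^- size v.
Proof.
move=> d0.
have /choice[g gP] : forall v, exists s : seq k, forall t : K, J e v != 0 ->
    N t * N (J e v) <= 2 * C ->
    exists2 q, q \in s & N (t - lift_k S q) * N (J e v) <= d * 2 ^- size v.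
  move=> v; have [v0|v0] := eqVneq (J e v) 0; first by exists [::].
  have Nv : 0 < N (J e v) by rewrite nrm_gt0.
  have h0 : 0 < d * 2 ^- size v / N (J e v).
    by rewrite divr_gt0// mulr_gt0// invr_gt0 exprn_gt0.
  have [s sP] := scalar_net S (2 * C / N (J e v)) h0.
  exists s => t _; rewrite -ler_pdivlMr// nrm_le => /sP[q qs].
  by rewrite -nrm_le ler_pdivlMr// => qt; exists q.
by exists g.
Qed.

(** The Gowers dichotomy. If the second alternative of the game never occurs,
    closeness within 1 / (n + 1) is forced for all n along one block sequence. *)
Theorem unconditional_or_indecomposable C e : basic S C e ->
  (exists (e' : nat -> X) C' D, basic S C' e' /\ suppression S D e') \/
  (exists e', basic S C e' /\ indecomposable e').
Proof.
move=> be; have [?|noU] := pselect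
  (exists (e' : nat -> X) C' D, basic S C' e' /\ suppression S D e'); first by left.
right; pose Q (n : nat) Z := accepts (close_pair n.+1%:R^-1 e) Z 0 0.
have [|n Z Z' m|z [bz _ zQ]] := @diagonal_block k Q setT large_setT.
- move=> n Z Zl; set d : R := n.+1%:R^-1.
  have d01 : 0 < d <= 1 by rewrite invr_gt0 ltr0n invf_le1// ler1n.
  have d40 : 0 < d / 4 by move/andP: d01 => [d0 _]; lra.
  have [g gP] := exists_scalar_nets e C d40.
  have [[Z' [Z'l Z'Z acc]]|[z [bz _ zP]]] :=
    game_dichotomy (close_pair d e) (poly_countable S) g Zl; first by exists Z'.
  case: noU; exists (J e \o z), C, (1 / 2 + 1 / d).
  have bez := basic_block be bz; split=> //.
  apply: (nets_suppression (C := C) (G := fun i => map (lift_k S) (g (z i)))) => //.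
    move=> i t /(gP _ _ (bez.1 i))[q qg qt]; exists (lift_k S q).
      exact: map_f.
    apply: le_trans qt _; apply: (ler_wpM2l (ltW d40)).
    rewrite lef_pV2 ?posrE ?exprn_gt0//.
    by rewrite ler_eXn2l ?ltr1n//; exact: block_size_ge.
  move=> m A c cG; have /choice[q qP] : forall i, exists q,
      q \in g (z i) /\ c i = lift_k S q.
    by move=> i; have /mapP[q qg ->] := cG i; exists q.
  have := zP m A q (fun i => (qP i).1); rewrite /close_pair => /negP; rewrite -leNgt.
  have sumJ (B : pred nat) : J e (\sum_(i < m | B i) q i *: z i) =
      \sum_(i < m | B i) c i *: (J e \o z) i.
    rewrite [LHS](big_morph (J e) (id1 := 0) (op1 := +%R)).
    - by apply: eq_bigr => i _; rewrite realizeZ (qP i).2.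
    - exact: realizeD.
    - exact: realize0.
  by rewrite (sumJ A) (sumJ (fun i => ~~ A i)) comb_flip (comb_split _ _ _ A).
- by move=> QZ Z'Z; exact: accepts_almost QZ Z'Z.
exists (J e \o z); split; first exact: basic_block.
move=> d U W d0 Ul Wl; pose n := Num.truncn d^-1.
have [||_ [_ [[u Uu <-] [w Ww <-]]]] :=
    zQ n _ _ (large_image bz Ul) (large_image bz Wl).
- by move=> _ [u _ <-]; exists u.
- by move=> _ [u _ <-]; exists u.
rewrite !add0r /close_pair !realize_combine => uw; exists u, w; split=> //.
apply: lt_le_trans uw _; rewrite ler_wpM2r ?nrm_ge0// invf_ple ?posrE//.
exact/ltW/truncnS_gt.
Qed.

(** * Subspaces reaching every tail *)

(** For a closed subspace of the span of e this amounts to being infinite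
    dimensional; it is the condition under which a large subspace can be found
    near A. *)
Definition reaches_tails e (A : set X) : Prop := forall m, exists y,
  [/\ A y, y != 0 & exists2 a, expansion S e a y & forall i, (i < m)%N -> a i = 0].

Section Approximation.
Variables (C : R) (e : nat -> X).
Hypothesis be : basic S C e.
Variable A : set X.
Hypotheses (As : GRing.submod_closed (mem A)) (At : reaches_tails e A).

(** Normalizing a coefficient of u to be exactly 1 is what will bound the
    coefficients of combinations of such vectors. *)
Lemma approximate_vector m (h : R) : 0 < h -> exists (u : {poly k}) p y,
  [/\ tail m u, u`_p = 1, A y & N (J e u - y) <= h * N (e p)].
Proof.
move=> h0; have [y [Ay y0 [a ay am]]] := At m.
have [p ap] : exists p, a p != 0.
  apply: contrapT => no; move/eqP: y0; apply; apply: (expansion_eq0 ay) => i.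
  by apply/eqP/negPn/negP => ai; apply: no; exists i.
have ep := basic_nrm_gt0 be p.
have [_ AP] := (submod_closedP A).1 As.
have {}Ay : A ((a p)^-1 *: y).
  rewrite -[_ *: y]addr0; apply: AP => //.
  by have [A0 _] := (submod_closedP A).1 As.
have zeroe : expansion S e (fun=> 0) 0.
  by move=> d d0; exists 0%N => n _; rewrite comb_eq0// subrr nrm0 ltW.
have := expansionP (a p)^-1 ay zeroe; rewrite addr0.
set b := (fun i => (a p)^-1 * a i + 0) => byy.
have bp : b p = 1 by rewrite /b addr0 mulVf.
have bm i : (i < m)%N -> b i = 0 by move=> im; rewrite /b (am _ im) mulr0 addr0.
have h2 : 0 < h * N (e p) / 2 by rewrite divr_gt0// mulr_gt0.
have [M bM] := byy _ h2; pose n := maxn M p.+1.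
have pm : (m <= p)%N by rewrite leqNgt; apply/negP => /am a0; move: ap; rewrite a0 eqxx.
have /choice[q qP] : forall i, exists q : k,
    [/\ (i < m)%N -> q = 0, i = p -> q = 1 &
     N (b i - lift_k S q) * N (e i) <= h * N (e p) / 2 * 2 ^- i.+1].
  move=> i; have r0 : 0 <= h * N (e p) / 2 * 2 ^- i.+1.
    by rewrite mulr_ge0 ?ltW// invr_ge0 exprn_ge0.
  have [im|mi] := ltnP i m.
    exists 0; split=> // [ip|]; first by move: im; rewrite ip ltnNge pm.
    by rewrite bm// rmorph0 subrr nrm0 mul0r.
  have [->|ip] := eqVneq i p.
    exists 1; split=> //.
    rewrite bp rmorph1 subrr nrm0 mul0r mulr_ge0 ?ltW// invr_ge0 exprn_ge0//.
  have ei := basic_nrm_gt0 be i.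
  have r1 : 0 < h * N (e p) / 2 * 2 ^- i.+1 / N (e i).
    by rewrite divr_gt0// mulr_gt0// invr_gt0 exprn_gt0.
  have [s sP] := scalar_net S (N (b i)) r1.
  have [|q _] := sP (b i); first by rewrite emb_nrm.
  rewrite -nrm_le ler_pdivlMr// => qb; exists q; split=> // ipE.
  by rewrite ipE eqxx in ip.
exists (\poly_(i < n) q i), p, ((a p)^-1 *: y).
have pn : (p < n)%N by rewrite leq_max ltnSn orbT.
split=> //.
- move=> i im; rewrite coef_poly; case: ifP => // _.
  by case: (qP i) => ->.
- by rewrite coef_poly pn; case: (qP p) => _ ->.
rewrite (@realizeE _ _ _ S _ e _ n) ?size_poly//.
rewrite (@eq_comb _ _ e _ (fun i => lift_k S (q i))); last first.
  by move=> i ilt; rewrite coef_poly ilt.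
have close : N (comb e (fun i => lift_k S (q i)) n - comb e b n) <= h * N (e p) / 2.
  by rewrite nrm_distC; apply: comb_close => [|i _]; [exact: ltW | case: (qP i)].
have := bM n (leq_maxl _ _).
have := nrm_dist S (comb e b n) (comb e (fun i => lift_k S (q i)) n) ((a p)^-1 *: y).
by lra.
Qed.

(** A block sequence of vectors u j, with coefficient 1 at p j, is chosen so
    close to A that the errors are summable. In a combination u of these
    vectors, the coefficient of u j is the coefficient of u at p j, and is
    controlled by the norm of u since e is basic. *)
Lemma approximate_subspace (d : R) : 0 < d -> exists U, large U /\
  forall u, U u -> exists2 y, A y & N (J e u - y) <= d * N (J e u).
Proof.
move=> d0; have C1 := basic_const_ge1 be.
have h0 j : 0 < d * 2 ^- j.+1 / (2 * C).
  rewrite divr_gt0 ?mulr_gt0// ?invr_gt0 ?exprn_gt0//; lra.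
have /choice[F FP] : forall mj : nat * nat, exists upy : {poly k} * nat * X,
    [/\ tail mj.1 upy.1.1, upy.1.1`_upy.1.2 = 1, A upy.2 &
     N (J e upy.1.1 - upy.2) <= d * 2 ^- mj.2.+1 / (2 * C) * N (e upy.1.2)].
  move=> [m j]; have [u [p [y uP]]] := approximate_vector m (h0 j).
  by exists (u, p, y).
pose w := fix w (j : nat) : {poly k} * nat * X := F (if j is i.+1 then size (w i).1.1 else 0%N, j).
pose z j := (w j).1.1; pose p j := (w j).1.2; pose y j := (w j).2.
have wP j : [/\ tail (if j is i.+1 then size (z i) else 0%N) (z j),
    (z j)`_(p j) = 1, A (y j) &
    N (J e (z j) - y j) <= d * 2 ^- j.+1 / (2 * C) * N (e (p j))].
  by have := FP (if j is i.+1 then size (z i) else 0%N, j); rewrite /z /p /y; case: j.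
have bz : block z.
  move=> j; split; last by case: (wP j.+1).
  apply/eqP => zj; have [_ + _ _] := wP j.
  by rewrite zj coef0 => /esym/eqP; rewrite oner_eq0.
exists (range (combine z)); split; first exact: (large_image bz large_setT).
move=> _ [q _ <-]; set u := combine z q.
exists (comb y (fun i => lift_k S q`_i) (size q)).
  have [A0 AP] := (submod_closedP A).1 As.
  elim: (size q) => [|n IH]; first by rewrite comb0.
  by rewrite combS addrC; apply: AP => //; case: (wP n).
have uE : J e u = comb (J e \o z) (lift_k S \o (fun i => q`_i)) (size q).
  exact: realize_comb.
rewrite [in X in N (X - _)]uE.
have coefu j : N (lift_k S q`_j) * N (e (p j)) <= 2 * C * N (J e u).
  have [_ zp _ _] := wP j.
  have -> : q`_j = u`_(p j) by rewrite (@coef_combine_block _ _ bz q j) zp ?mulr1 ?oner_neq0.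
  have [pu|up] := ltnP (p j) (size u).
    exact: (comb_coef be (fun i => lift_k S u`_i) pu).
  rewrite nth_default// rmorph0 nrm0 mul0r !mulr_ge0 ?nrm_ge0//; lra.
rewrite /comb -sumrB; apply: le_trans (nrm_sum _ _) _.
apply: (@le_trans _ _ (\sum_(j < size q) d * N (J e u) * 2 ^- j.+1)); last first.
  by rewrite -mulr_sumr ler_piMr ?halves_sum// mulr_ge0 ?nrm_ge0// ltW.
apply: ler_sum => j _; rewrite -scalerBr nrmZ /=.
have [_ _ _ zy] := wP j.
apply: le_trans (ler_wpM2l (nrm_ge0 _ _) zy) _.
rewrite mulrCA; apply: le_trans (ler_wpM2l (ltW (h0 j)) (coefu j)) _.
have C20 : 2 * C != 0 by rewrite gt_eqF//; lra.
by rewrite mulrA divfK// mulrAC.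
Qed.

End Approximation.
End Dichotomy.

(** * Subprojective spaces *)

Section Subprojective.
Context {R : realType} {K : numFieldType} {k : fieldType}.
Variable S : scalars R K k.
Context {X : normedModType K}.
Local Notation N := (nrm S).
Local Notation J := (realize S).
Implicit Types (e : nat -> X).

(** Finitely many coordinates cannot separate the points of Z. *)
Lemma reaches_tails_subspace C e (Z : set X) : basic S C e -> banach_subspace Z ->
  (forall x, Z x -> exists a, expansion S e a x) -> reaches_tails S e Z.
Proof.
move=> be [Zs _ Zinf] Ze m.
have /choice[c cP] : forall x, exists a, Z x -> expansion S e a x.
  move=> x; have [/Ze[a ax]|nZx] := pselect (Z x); first by exists a.
  by exists (fun=> 0).
have clin i : linear_on Z (fun x => c x i).
  move=> t x y Zx Zy; have [_ ZP] := (submod_closedP Z).1 Zs.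
  have := expansionP t (cP x Zx) (cP y Zy).
  by move/(expansion_unique be (cP _ (ZP t _ _ Zx Zy)))/(congr1 (fun f => f i)).
have [y [Zy y0 cy]] := exists_kernel m Zs clin Zinf.
by exists y; split=> //; exists (c y) => //; exact: cP.
Qed.

Lemma expansion_linear e (c : nat -> nat -> K) (f : nat -> X) (t : nat -> K) n :
  (forall j, expansion S e (c j) (f j)) ->
  expansion S e (fun i => \sum_(j < n) t j * c j i) (comb f t n).
Proof.
move=> cf; elim: n => [|n IH].
  by move=> d d0; exists 0%N => n _; rewrite !comb0 subr0 comb_eq0 ?nrm0 ?ltW// => i _;
    rewrite big_ord0.
rewrite combS addrC; have := expansionP (t n) (cf n) IH; congr (expansion S e _ _).
by apply/funext => i; rewrite big_ord_recr addrC.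
Qed.

(** The odd terms, corrected by their projections, lie in the kernel; since
    the corrections have even support, m + 1 of them have a nonzero
    combination vanishing on the first m coordinates. *)
Lemma reaches_tails_kernel C e (P : {linear X -> X}) : basic S C e ->
  (forall x, P (P x) = P x) ->
  (forall x, span_on S e (fun i => ~~ odd i) (P x)) ->
  reaches_tails S e [set x | P x = 0].
Proof.
move=> be PP Pev m; pose o j := j.*2.+1.
have /choice[a aP] : forall j, exists a,
    expansion S e a (P (e (o j))) /\ forall i, odd i -> a i = 0.
  by move=> j; have [a ae a0] := Pev (e (o j)); exists a; split=> // i io;
    apply: a0; rewrite negbK.
pose c j i := (i == o j)%:R - a j i; pose f j := e (o j) - P (e (o j)).
have cf j : expansion S e (c j) (f j).
  apply: expansionB; last by case: (aP j).
  by move=> d d0; exists (o j).+1 => n on; rewrite comb_delta// subrr nrm0 ltW.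
have [t [[l lm tl] t0]] := kernel_vector m c.
exists (comb f t m.+1); split.
- rewrite /= /comb linear_sum big1// => j _.
  by rewrite linearZ /= /f linearB /= PP subrr scaler0.
- have bE := expansion_linear t m.+1 cf; apply/eqP => b0; rewrite b0 in bE.
  have := expansion0_coef be bE (o l); rewrite (bigD1 (Ordinal lm))//= big1.
    rewrite /c eqxx (aP l).2 ?subr0 ?mulr1 ?addr0 /= ?odd_double//.
    by move=> tl0; rewrite tl0 eqxx in tl.
  move=> j jl; rewrite /c (aP j).2 /= ?odd_double// subr0.
  rewrite eqSS (inj_eq double_inj) (_ : (l == j)%N = false) ?mulr0//.
  by rewrite eq_sym; apply: negbTE; rewrite -val_eqE in jl.
- by exists (fun i => \sum_(j < m.+1) t j * c j i); first exact: expansion_linear.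
Qed.

(** If y in the range of P and b in its kernel are close relative to the sum
    of their norms, then so is y = P (y - b) to 0, and b as well. *)
Lemma subprojective_decomposable C e : basic S C e -> subprojective X ->
  ~ indecomposable S e.
Proof.
move=> be Xsub ind.
have [|Z [Zsub ZY [P [Pc PP PZ]]]] := Xsub (span_on S e (fun i => ~~ odd i)).
  apply: (span_on_subspace be (s := double)); first exact: double_inj.
  by move=> n; rewrite odd_double.
have [M M0 PM] := linear_bound S Pc.
have Zs : GRing.submod_closed (mem Z) by case: Zsub.
have PrZ x : Z (P x) by rewrite -PZ; exists x.
have Zfix x : Z x -> P x = x by rewrite -PZ => -[y _ <-].
have Zt : reaches_tails S e Z.
  by apply: reaches_tails_subspace be Zsub _ => x /ZY[a ax _]; exists a.
pose B := [set x | P x = 0].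
have Bs : GRing.submod_closed (mem B).
  apply/submod_closedP; split; first by rewrite /B /= linear0.
  by move=> t x y /= Px Py; rewrite /B /= linearP Px Py scaler0 addr0.
have Bt : reaches_tails S e B.
  by apply: reaches_tails_kernel be PP _ => x; apply/ZY/PrZ.
(* The total relative error 4 * h * M + 3 * h has to be less than 1. *)
pose h : R := 1 / (8 * (M + 1)).
have M8 : 0 < 8 * (M + 1) by lra.
have h0 : 0 < h by rewrite divr_gt0.
have hM : h * (8 * (M + 1)) = 1 by rewrite /h divfK// gt_eqF.
have [U [Ul UZ]] := approximate_subspace be Zs Zt h0.
have [W [Wl WB]] := approximate_subspace be Bs Bt h0.
have [u [w [/UZ[y Zy uy] /WB[b Bb wb] uw]]] := ind h U W h0 Ul Wl.
have y1 : N y <= M * N (y - b).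
  by have := PM (y - b); rewrite linearB /= (Zfix y Zy) Bb subr0.
have b1 : N b <= N y + N (y - b).
  by have := nrm_sub S b y; rewrite (nrm_distC S b).
move: uw; rewrite /close_pair.
have yb : N (y - b) <= N (J e u - J e w) + N (J e u - y) + N (J e w - b).
  have := nrm_dist S (J e u) y b; have := nrm_dist S (J e w) (J e u) b.
  rewrite (nrm_distC S y (J e u)); lra.
have := nrmD S (J e u) (J e w).
have := nrm_sub S (J e u) y; have := nrm_sub S (J e w) b.
have := nrm_ge0 S (J e u - J e w).
move: uy wb y1 b1 yb.
move: (N (J e u - J e w)) (N (J e u + J e w)) (N (J e u)) (N (J e w))
  (N (J e u - y)) (N (J e w - b)) (N y) (N b) (N (y - b)).
move=> dd ss nu nw du dw ny nb nyb *.
have h8 : h <= 1 / 8 by rewrite /h ler_pdivrMr//; nra.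
have s1 : dd + du + dw <= 2 * h * (nu + nw) by nra.
have s2 : nyb <= 2 * h * (nu + nw) by lra.
have s3 : ny <= M * (2 * h * (nu + nw)) by nra.
have s4 : nu + nw <= 2 * ny + nyb + h * (nu + nw) by lra.
have hM' : h * M = 1 / 8 - h by lra.
have s5 : nu + nw <= (4 * (h * M) + 3 * h) * (nu + nw) by lra.
have s6 : 0 < ss by nra.
have s7 : 0 < h * (nu + nw) by apply: mulr_gt0 => //; lra.
suff : (0 : R) < 0 by rewrite ltxx.
by rewrite hM' in s5; lra.
Qed.

Theorem subprojective_unconditional : infinite_dimensional X -> subprojective X ->
  exists (Y : set X) (e : nat -> X), banach_subspace Y /\ unconditional_basis Y e.
Proof.
move=> Xinf Xsub; have [e be] := exists_basic S Xinf.
have [[e' [C [D [be' sD]]]]|[e' [be' ind]]] := unconditional_or_indecomposable be.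
  exact: suppression_unconditional be' sD.
by case: (subprojective_decomposable be' Xsub ind).
Qed.

End Subprojective.

(** * Real and complex scalars *)

Lemma real_dense (R : realType) (a d : R) : 0 < d ->
  exists q : rat, `|a - ratr q| <= d.
Proof.
move=> d0; have [|q] := @rat_in_itvoo _ (a - d) (a + d); first by lra.
rewrite in_itv /= => /andP[h1 h2]; exists q.
by rewrite ler_norml; apply/andP; split; lra.
Qed.

Lemma real_net (R : realType) (r d : R) : 0 < d -> exists s : seq rat,
  forall a : R, `|a| <= r -> exists2 q, q \in s & `|a - ratr q| <= d.
Proof.
move=> d0; pose M := Num.truncn (2 * r / (d / 2)).
have /choice[q qP] : forall i : nat, exists q : rat,
    `|(- r + i%:R * (d / 2)) - ratr q| <= d / 2.
  by move=> i; apply: real_dense; lra.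
exists [seq q i | i <- iota 0 M.+1] => a; rewrite ler_norml => /andP[ra ar].
have x0 : 0 <= (a + r) / (d / 2) by apply: divr_ge0; lra.
pose i := Num.truncn ((a + r) / (d / 2)).
have /andP[] := truncn_itv x0; rewrite -/i => i1 i2.
have d2 : 0 < d / 2 by lra.
exists (q i).
  apply: map_f; rewrite mem_iota add0n ltnS /=; apply: le_truncn.
  by rewrite ler_wpM2r ?invr_ge0//; lra.
move: i1 i2; rewrite ler_pdivlMr// ltr_pdivrMr// -[i.+1%:R]natr1 => i1 i2.
have := qP i; rewrite !ler_norml => /andP[h1 h2]; apply/andP; split; lra.
Qed.

Lemma real_complete (R : realType) (u : nat -> R) :
  (forall d : R, 0 < d ->
    exists N, forall m n, (N <= m)%N -> (N <= n)%N -> `|u m - u n| <= d) ->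
  exists l, forall d : R, 0 < d -> exists N, forall n, (N <= n)%N -> `|u n - l| <= d.
Proof.
move=> uc; suff /cvg_ex[l /cvgrPdist_le ul] : cvg (u @ \oo).
  by exists l => d /ul[N _ uN]; exists N => n /uN; rewrite distrC.
apply: cauchy_cvg; apply: cauchy_exP => d d0.
have d20 : 0 < d / 2 by lra.
have [N uN] := uc _ d20; exists (u N); exists N => // n Nn /=.
rewrite -ball_normE /ball_ /=.
by have := uN _ _ (leqnn N) Nn; lra.
Qed.

Lemma countable_poly (k : fieldType) (f : k -> nat) : injective f ->
  countable [set: {poly k}].
Proof.
move=> fI; apply/countable_injP; exists (fun p : {poly k} => pickle (map f p)).
move=> p q _ _ /(pcan_inj pickleK)/(inj_map fI); exact: poly_inj.
Qed.

Definition real_scalars (R : realType) : scalars R R rat.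
Proof.
apply: (@Scalars R R rat idfun id ratr) => //.
- apply: countable_poly (pcan_inj pickleK).
- exact: real_net.
- exact: real_complete.
Defined.

Section Complex.
Variable R : realType.
Local Open Scope complex_scope.

Lemma normc_le2 (x : R[i]) (d : R) :
  `|complex.Re x| <= d -> `|complex.Im x| <= d -> `|x| <= (2 * d)%:C.
Proof.
move=> xr xi; have d0 : 0 <= d by exact: le_trans xr.
rewrite normc_def lecR -[leRHS]ger0_norm ?mulr_ge0// -sqrtr_sqr ler_wsqrtr//.
move: xr xi; rewrite !ler_norml => /andP[a1 a2] /andP[b1 b2]; nra.
Qed.

Lemma normc_leRe (x : R[i]) (d : R) : `|x| <= d%:C -> `|complex.Re x| <= d.
Proof.
rewrite normc_def lecR; apply: le_trans.
by rewrite -sqrtr_sqr ler_wsqrtr// lerDl sqr_ge0.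
Qed.

Lemma normc_leIm (x : R[i]) (d : R) : `|x| <= d%:C -> `|complex.Im x| <= d.
Proof.
rewrite normc_def lecR; apply: le_trans.
by rewrite -sqrtr_sqr ler_wsqrtr// lerDr sqr_ge0.
Qed.

Definition ratc (z : rat[i]) : R[i] :=
  Complex (ratr (complex.Re z)) (ratr (complex.Im z)).

Lemma ratc_is_zmod_morphism : zmod_morphism ratc.
Proof. by move=> [a b] [c d]; rewrite /ratc /= !rmorphB. Qed.

Lemma ratc_is_monoid_morphism : monoid_morphism ratc.
Proof.
split; first by rewrite /ratc /= rmorph1 rmorph0.
by move=> [a b] [c d]; rewrite /ratc /= rmorphB rmorphD !rmorphM.
Qed.

HB.instance Definition _ :=
  GRing.isZmodMorphism.Build rat[i] R[i] ratc ratc_is_zmod_morphism.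
HB.instance Definition _ :=
  GRing.isMonoidMorphism.Build rat[i] R[i] ratc ratc_is_monoid_morphism.

Lemma complex_net (r d : R) : 0 < d -> exists s : seq rat[i],
  forall a : R[i], `|a| <= r%:C -> exists2 q, q \in s & `|a - ratc q| <= d%:C.
Proof.
move=> d0; have d20 : 0 < d / 2 by lra.
have [s sP] := real_net r d20.
exists [seq Complex p q | p <- s, q <- s] => -[a b] ab.
have [p ps pa] := sP a (normc_leRe ab); have [q qs qb] := sP b (normc_leIm ab).
exists (Complex p q); first by apply/allpairsP; exists (p, q).
by rewrite (_ : d = 2 * (d / 2)); [apply: normc_le2 | lra].
Qed.

Lemma complex_complete (u : nat -> R[i]) :
  (forall d : R, 0 < d ->
    exists N, forall m n, (N <= m)%N -> (N <= n)%N -> `|u m - u n| <= d%:C) ->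
  exists l, forall d : R, 0 < d ->
    exists N, forall n, (N <= n)%N -> `|u n - l| <= d%:C.
Proof.
move=> uc.
have subE x y : complex.Re (x - y) = complex.Re x - complex.Re y :> R /\
    complex.Im (x - y) = complex.Im x - complex.Im y :> R by case: x y => [a b] [].
have [|a aP] := @real_complete R (fun n => complex.Re (u n)).
  move=> d /uc[N uN]; exists N => m n Nm Nn; rewrite -(subE _ _).1.
  exact: normc_leRe (uN _ _ Nm Nn).
have [|b bP] := @real_complete R (fun n => complex.Im (u n)).
  move=> d /uc[N uN]; exists N => m n Nm Nn; rewrite -(subE _ _).2.
  exact: normc_leIm (uN _ _ Nm Nn).
exists (Complex a b) => d d0; have d20 : 0 < d / 2 by lra.
have [N aN] := aP _ d20; have [M bM] := bP _ d20.
exists (maxn N M) => n; rewrite geq_max => /andP[/aN na /bM nb].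
rewrite (_ : d = 2 * (d / 2)); last by lra.
by apply: normc_le2; rewrite ?(subE _ _).1 ?(subE _ _).2.
Qed.

Definition complex_scalars : scalars R R[i] rat[i].
Proof.
apply: (@Scalars R R[i] rat[i] (real_complex R) (@complex.Re R) ratc).
- by move=> r; rewrite ler0c.
- by move=> [a b]; rewrite lecE /= => /andP[/eqP -> _].
- exact: (@countable_poly rat[i] (@pickle rat[i]) (pcan_inj pickleK)).
- exact: complex_net.
- exact: complex_complete.
Defined.

End Complex.

(* Real and complex Banach spaces. *)
Theorem proposition2p9 (R : realType) :
  (forall X : completeNormedModType R,
     infinite_dimensional X -> subprojective X ->
     exists (Y : set X) (e : nat -> X), banach_subspace Y /\ unconditional_basis Y e) /\
  (forall X : completeNormedModType (complex R),
     infinite_dimensional X -> subprojective X ->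
     exists (Y : set X) (e : nat -> X), banach_subspace Y /\ unconditional_basis Y e).
Proof.
split=> X; first exact: (subprojective_unconditional (real_scalars R)).
exact: (subprojective_unconditional (complex_scalars R)).
Qed.
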